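(* Let $m\ge2$, let $\mathbf{u}$ be a $C^1$ velocity field on $\mathbb{R}^m\times\mathbb{R}$ with flow map $\phi$, let $t_0\in\mathbb{R}$, $k>0$, and let $\mathcal{S}(t)$, $t\in[t_0,t_0+k]$, be a moving hypersurface. The generating cycle $\mathcal{G}_{\mathcal{D}}(t_0,k)$ is orientable and $$\mathcal{G}_{\mathcal{D}}(t_0,k)=\chi(\partial\mathbb{B}^m),\qquad \chi(\mathbf{z},\tau):=\phi_{t_0+\tau k}^{-\tau k}(\mathcal{S}(\mathbf{z},t_0+\tau k)).$$ Furthermore, there exist a parametrization $\psi:\partial\mathbb{B}^m\to\mathbb{R}^m$ and an orientation of $\mathcal{G}_{\mathcal{D}}(t_0,k)$ such that, with the rule for outward normals of cycles on the faces $z_i=0$ and $z_i=1$ of $\mathbb{B}^m$ recalled in the context: the normal vector of $\mathcal{S}(t_0)$ is determined by the rule for the face $z_m=0$ (and is thus the same as the outward normal vector of the hypersurface $\mathcal{S}(t_0)$); the normal vector of $\phi_{t_0+k}^{-k}(\mathcal{S}(t_0+k))$ is determined by the rule for the face $z_m=1$; and the normal vector of the streak hypersurface $\Psi_{\partial\mathcal{S}}(t_0,k)$ is determined by the rules for the faces $z_i=0,1$ with $i<m$.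
   Context: $\mathbb{B}^m:=(0,1)^m$ is the open $m$-cube. A wedge product of $m$ vectors of $\mathbb{R}^m$ is identified with the determinant of the matrix having these vectors as its columns in order. Flow map: the ODE $\frac{d\mathbf{x}}{dt}=\mathbf{u}(\mathbf{x},t)$ is assumed to have, for every initial time and position, a unique solution defined for all times; $\phi_{t_0}^{s}(\mathbf{p})$ is the position at time $t_0+s$ ($s\in\mathbb{R}$) of the particle located at $\mathbf{p}$ at time $t_0$. Moving hypersurface: a $C^1$ map $\mathcal{S}:\overline{\mathbb{B}^{m-1}}\times[t_0,t_0+k]\to\mathbb{R}^m$ such that for each $t$ the map $\mathcal{S}(\cdot,t)$ restricted to $\mathbb{B}^{m-1}$ is injective with derivative of rank $m-1$ everywhere; the point set $\mathcal{S}(t):=\{\mathcal{S}(\mathbf{z},t):\mathbf{z}\in\mathbb{B}^{m-1}\}$ is homeomorphic to $\mathcal{S}(t_0)$ for all $t$. The outward normal of the hypersurface $\mathcal{S}(t)$ at $\mathcal{S}(\mathbf{z},t)$ is the unit vector $\mathbf{n}$ orthogonal to all $\partial_{z_i}\mathcal{S}(\mathbf{z},t)$ with $\left(\bigwedge_{i=1}^{m-1}\partial_{z_i}\mathcal{S}(\mathbf{z},t)\right)\wedge\mathbf{n}<0$. Generating cycle: $\mathcal{G}_{\mathcal{D}}(t_0,k):=\mathcal{S}(t_0)\cup\phi_{t_0+k}^{-k}(\mathcal{S}(t_0+k))\cup\Psi_{\partial\mathcal{S}}(t_0,k)$, where the streak hypersurface is $\Psi_{\partial\mathcal{S}}(t_0,k):=\{\phi_{t_0+\tau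 k}^{-\tau k}(\mathbf{x}):\mathbf{x}=\mathcal{S}(\mathbf{z},t_0+\tau k),\ \mathbf{z}\in\partial\mathbb{B}^{m-1},\ \tau\in[0,1]\}$. A (spherical) cycle is the image of a continuous map $\psi:\partial\mathbb{B}^m\to\mathbb{R}^m$; it is oriented intrinsically through its parametrization by the following rule. At a point $\mathbf{z}\in\partial\mathbb{B}^m$ with $z_i=s$, $s\in\{0,1\}$, and other coordinates in $(0,1)$, the outward normal is the unit vector $\mathbf{n}(\mathbf{z})$ orthogonal to $\partial_{z_k}\psi(\mathbf{z})$ for all $k\ne i$ such that $\left(\bigwedge_{k=1}^{i-1}\partial_{z_k}\psi\right)\wedge\mathbf{n}\wedge\left(\bigwedge_{k=i+1}^{m}\partial_{z_k}\psi\right)$ is $\le0$ on the face $z_i=0$ and $\ge0$ on the face $z_i=1$ (equality occurs only at singular points). *)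

(* Defs.v *)
From HB Require Import structures.
From mathcomp Require Import all_boot all_order all_algebra.
From mathcomp Require Import all_classical all_reals all_analysis.
Import numFieldNormedType.Exports.
Set Implicit Arguments.
Unset Strict Implicit.
Unset Printing Implicit Defensive.
Import Order.TTheory GRing.Theory Num.Theory.
Local Open Scope classical_set_scope.
Local Open Scope ring_scope.

(* Points of R^m are row vectors 'rV[R]_m.  The ambient dimension is m = n.+1,
   so that hypersurfaces are parametrized by the cube of R^n = R^(m-1). *)

Definition frontier (T : topologicalType) (A : set T) : set T :=
  closure A `\` interior A.

Definition homeomorphic (T : topologicalType) (A B : set T) : Prop :=
  exists f g : T -> T,
    [/\ set_bij A B f, {in A, cancel f g},
        {within A, continuous f} & {within B, continuous g}].

(* C^1 on a set A that need not be open, in the sense of derivatives relative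
   to A.  On sets such as closed boxes, where the relative derivative is unique,
   it is equivalent to having a C^1 extension. *)
Definition C1_on (R : realType) (V W : normedModType R)
    (A : set V) (f : V -> W) : Prop :=
  exists Df : V -> {linear V -> W},
    (forall x, A x -> forall e : R, 0 < e ->
       \forall y \near within A (nbhs x),
         `|f y - f x - Df x (y - x)| <= e * `|y - x|) /\
    (forall v, {within A, continuous (fun x => Df x v)}).

Section Vectors.
Context {R : realType}.

(* The norm `|v| of 'rV[R]_m is the sup norm; Euclidean unit vectors are the v
   with dotp v v = 1. *)
Definition dotp m (v w : 'rV[R]_m) : R := (v *m w^T) 0 0.

Definition wedge m (v : 'I_m -> 'rV[R]_m) : R := \det (\matrix_(i, j) v j 0 i).

Definition basis_vec m (k : 'I_m) : 'rV[R]_m := delta_mx 0 k.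

Definition pderiv m p (f : 'rV[R]_m -> 'rV[R]_p) (k : 'I_m) (z : 'rV[R]_m) :
  'rV[R]_p := 'D_(basis_vec k) f z.

Definition cube m : set 'rV[R]_m := [set z | forall i, 0 < z 0 i < 1].

(* The relatively open face z_i = s of the unit cube, s = false standing for 0
   and s = true for 1. *)
Definition face m (i : 'I_m) (s : bool) : set 'rV[R]_m :=
  [set z | z 0 i = s%:R /\ forall j, j != i -> 0 < z 0 j < 1].

End Vectors.
Arguments cube {R} m.

Section Flow.
Context {R : realType} {m : nat}.
Implicit Types (u : 'rV[R]_m -> R -> 'rV[R]_m).

Definition C1_velocity u : Prop :=
  let U := fun q : 'rV[R]_m * R => u q.1 q.2 in
  (forall q, differentiable U q) /\ (forall v, continuous (fun q => 'd U q v)).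

Definition ode_solution u (t0 : R) (p : 'rV[R]_m) (x : R -> 'rV[R]_m) : Prop :=
  x t0 = p /\ forall t : R, is_derive t 1 x (u (x t) t).

Definition well_posed u : Prop :=
  forall t0 p, exists! x, ode_solution u t0 p x.

(* phi t0 s p is the position at time t0 + s of the particle located at p at
   time t0. *)
Definition is_flow_map u (phi : R -> R -> 'rV[R]_m -> 'rV[R]_m) : Prop :=
  forall t0 p x, ode_solution u t0 p x -> forall s, phi t0 s p = x (t0 + s).

End Flow.

Section Hypersurface.
Context {R : realType} {n : nat}.
Implicit Types (S : 'rV[R]_n -> R -> 'rV[R]_n.+1).

Definition hsurf S (t : R) : set 'rV[R]_n.+1 := (fun z => S z t) @` cube n.

Definition moving_hypersurface S (t0 k : R) : Prop :=
  [/\ C1_on (closure (cube n) `*` `[t0, t0 + k]) (fun q => S q.1 q.2),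
      forall t, t0 <= t <= t0 + k -> set_inj (cube n) (fun z => S z t),
      forall t, t0 <= t <= t0 + k -> forall z, cube n z ->
        \rank ('J (fun z => S z t) z) = n
    & forall t, t0 <= t <= t0 + k -> homeomorphic (hsurf S t) (hsurf S t0)].

(* The sign condition is d_1 S /\ ... /\ d_(m-1) S /\ v < 0. *)
Definition hsurf_normal S (t : R) (z : 'rV[R]_n) (v : 'rV[R]_n.+1) : Prop :=
  let St := fun z => S z t in
  [/\ dotp v v = 1, forall i, dotp v (pderiv St i z) = 0
    & wedge (fun j => if unlift ord_max j is Some i then pderiv St i z else v)
        < 0].

End Hypersurface.

Section Cycle.
Context {R : realType} {m : nat}.
Implicit Types (psi N : 'rV[R]_m.+1 -> 'rV[R]_m.+1) (C : set 'rV[R]_m.+1).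

(* Only the values of psi on the frontier of the cube matter. *)
Definition cycle_param psi C : Prop :=
  {within frontier (cube m.+1), continuous psi} /\
  psi @` frontier (cube m.+1) = C.

Definition regular_point psi (i : 'I_m.+1) (z : 'rV[R]_m.+1) : bool :=
  row_free (row' i (\matrix_k pderiv psi k z)).

(* v is an outward normal at the point z of the face z_i = s.  Only the partial
   derivatives along the face (indices other than i) are involved. *)
Definition cycle_normal psi (i : 'I_m.+1) (s : bool) (z v : 'rV[R]_m.+1) :
    Prop :=
  let w := wedge (fun k => if k == i then v else pderiv psi k z) in
  [/\ dotp v v = 1, forall k, k != i -> dotp v (pderiv psi k z) = 0,
      if s then 0 <= w else w <= 0
    & w = 0 -> ~~ regular_point psi i z].

(* The field N of unit vectors on the open faces is an orientation of the cycle
   parametrized by psi: the partial derivatives entering the rule exist, N obeys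
   the rule, and N is continuous along each face at regular points. *)
Definition cycle_orientation psi N : Prop :=
  forall i s z, face i s z ->
    [/\ forall k, k != i -> derivable psi z (basis_vec k),
        cycle_normal psi i s z (N z)
      & regular_point psi i z ->
          N x @[x --> within (face i s) (nbhs z)] --> N z].

Definition orientable_cycle C : Prop :=
  exists psi N, cycle_param psi C /\ cycle_orientation psi N.

(* The lateral boundary of the cube: the closed faces z_i = 0, 1 with i < m. *)
Definition lateral_faces : set 'rV[R]_m.+1 :=
  [set z | exists i s, i != ord_max /\ closure (face i s) z].

End Cycle.

Section GeneratingCycle.
Context {R : realType} {n : nat}.
Variables (phi : R -> R -> 'rV[R]_n.+1 -> 'rV[R]_n.+1).
Variables (S : 'rV[R]_n -> R -> 'rV[R]_n.+1) (t0 k : R).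

Definition streak_hsurf : set 'rV[R]_n.+1 :=
  [set y | exists z tau, [/\ frontier (cube n) z, 0 <= tau <= 1
     & y = phi (t0 + tau * k) (- (tau * k)) (S z (t0 + tau * k))]].

Definition pulled_back_hsurf : set 'rV[R]_n.+1 :=
  phi (t0 + k) (- k) @` hsurf S (t0 + k).

Definition generating_cycle : set 'rV[R]_n.+1 :=
  hsurf S t0 `|` pulled_back_hsurf `|` streak_hsurf.

(* A point of R^m is read as (z, tau), with tau its last coordinate. *)
Definition chi (y : 'rV[R]_n.+1) : 'rV[R]_n.+1 :=
  let z := col' ord_max y in
  let tau := y 0 ord_max in
  phi (t0 + tau * k) (- (tau * k)) (S z (t0 + tau * k)).

End GeneratingCycle.

(* Main.v *)
Require Import Defs.
From HB Require Import structures.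
From mathcomp Require Import all_boot all_order all_algebra.
From mathcomp Require Import all_classical all_reals all_analysis.
From mathcomp Require Import ring lra.
Import numFieldNormedType.Exports.
Set Implicit Arguments.
Unset Strict Implicit.
Unset Printing Implicit Defensive.
Import Order.TTheory GRing.Theory Num.Theory.
Local Open Scope classical_set_scope.
Local Open Scope ring_scope.

(* The parametrization is psi = chi.  Write F (t, p) for the position at time t0
   of the particle located at p at time t, so that
   chi (z, tau) = F (t0 + tau k, S (z, t0 + tau k)).  The analytic core is that F
   is C^1, that its derivative in p is invertible and that
   d_t F = - d_p F (u (p, t)): the partial derivatives of chi along each face then
   exist, are continuous, and on the faces z_m = 0, 1 are the images of the
   tangents of S under an invertible matrix.

   C^1 dependence on the initial position is obtained without solving the
   variational equation: by Taylor's formula for u, a difference of trajectories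
   solves it up to a small error, so by Gronwall's inequality the difference
   quotients of F are uniformly Cauchy, and their limits give the derivative.

   The outward normal on a face is the normalized generalized cross product of the
   tangents (their cofactors), which is continuous where it does not vanish, that
   is, at the regular points. *)

(** The velocity is only locally Lipschitz, so trajectories near a given one are first confined to a
    common ball by a bootstrap; there Gronwall's constants no longer depend on the trajectory. The
    resulting estimates are uniform in the base point: the flow is strictly differentiable, and this
    is what makes its derivative continuous. The formula for [d_t F] comes from the flow law:
    starting at [p] a time [s] later amounts, to first order, to starting at [p - s u (p, t)] at the
    original time.

    [S] is differentiable only relative to a closed box. A short line in a relatively open face
    stays in that box in both directions, so the tangential derivatives of [chi] are genuine
    two-sided ones, on the lateral faces too. There [chi] may be singular; a unit normal obeying the
    rule still exists but need not be unique, so it is picked by choice. The faces [z_m = 0, 1] have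
    no singular point, so their normal is unique; at [z_m = 0] no time elapses and the tangents are
    those of [S(t0)] itself. *)

(** * Matrix norms, limits and derivatives *)

Lemma ler_coord_norm (R : realType) m n (A : 'M[R]_(m, n)) i j :
  `|A i j| <= `|A|.
Proof.
rewrite [leRHS]/Num.Def.normr/= mx_normrE.
exact: (le_bigmax _ (fun ij => `|A ij.1 ij.2|) (i, j)).
Qed.

Lemma mx_norm_le (R : realType) m n (A : 'M[R]_(m, n)) (e : R) :
  0 <= e -> (forall i j, `|A i j| <= e) -> `|A| <= e.
Proof.
move=> e0 Ae; rewrite [leLHS]/Num.Def.normr/= mx_normrE.
by apply: bigmax_le => // -[i j] _; exact: Ae.
Qed.

Lemma cvg_mxP (R : realType) (T : Type) (F : set_system T) {FF : Filter F} m n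
    (f : T -> 'M[R]_(m, n)) (l : 'M[R]_(m, n)) :
  f x @[x --> F] --> l <-> forall i j, f x i j @[x --> F] --> l i j.
Proof.
split=> [fl i j|fl].
  exact: (cvg_comp f (fun M : 'M[R]_(m, n) => M i j) fl (@coord_continuous _ _ _ i j l)).
apply/cvgrPdist_le => e e0; near=> x.
apply: mx_norm_le (ltW e0) _ => i j; rewrite !mxE; move: i j; near: x.
apply: filter_forall => i; apply: filter_forall => j.
exact: ((cvgrPdist_le _ _).1 (fl i j)).
Unshelve. all: by end_near. Qed.

Lemma ler_norm_mulmx (R : realType) m n (v : 'rV[R]_m) (A : 'M[R]_(m, n)) :
  `|v *m A| <= m%:R * `|v| * `|A|.
Proof.
apply: mx_norm_le => [|i j]; first by rewrite !mulr_ge0.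
rewrite mxE (le_trans (ler_norm_sum _ _ _))//.
rewrite (@le_trans _ _ (\sum_(k < m) `|v| * `|A|))//.
  by apply: ler_sum => k _; rewrite normrM ler_pM// ler_coord_norm.
by rewrite sumr_const card_ord -[leRHS]mulrA mulr_natl.
Qed.

Lemma cvg_mulmx (R : realType) (T : Type) (F : set_system T) {FF : Filter F}
    m n p (f : T -> 'M[R]_(m, n)) (g : T -> 'M[R]_(n, p))
    (A : 'M[R]_(m, n)) (B : 'M[R]_(n, p)) :
  f x @[x --> F] --> A -> g x @[x --> F] --> B ->
  f x *m g x @[x --> F] --> A *m B.
Proof.
move=> /cvg_mxP fA /cvg_mxP gB; apply/cvg_mxP => i j.
rewrite mxE; under eq_fun do rewrite mxE.
apply: cvg_big => [|k _]; first exact: add_continuous.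
apply: cvgM; [exact: fA|exact: gB].
Qed.

(** Uniform continuity in which [y] may leave [K]: in [velocity_taylor] the segment from [x] to [y]
    can leave the box. *)
Lemma compact_near_uniform (R : realType) (V W : normedModType R) (K : set V)
    (f : V -> W) (e : R) :
  compact K -> continuous f -> 0 < e ->
  exists2 d : R, 0 < d & forall x y, K x -> `|y - x| < d -> `|f y - f x| <= e.
Proof.
move=> /compact_near_coveringP Kc fc e0.
have /= := Kc R (0^'+) (fun d x => forall y, `|y - x| < d -> `|f y - f x| <= e).
case=> [x Kx|d /= d0 H].
  have /cvgrPdist_le /(_ (e / 2)) := fc x.
  rewrite divr_gt0// => /(_ isT) /nbhs_normP[r /= r0 rf].
  exists (ball x (r / 2), [set d | 0 < d < r / 2]).
    split=> /=; first by apply: nbhsx_ballx; rewrite divr_gt0.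
    exists (r / 2); first by rewrite /= divr_gt0.
    by move=> d /=; rewrite sub0r normrN => dr d0; rewrite d0 -[ltLHS]gtr0_norm.
  case=> x' d /= [xx' /andP[d0 dr]] y yx'.
  move: xx'; rewrite -ball_normE/= => xx'.
  rewrite -(subrKA (f x)) (le_trans (ler_normD _ _))// (splitr e) lerD//.
    rewrite distrC rf//= -(subrKA x') (le_lt_trans (ler_normD _ _))//.
    by rewrite (splitr r) ltrD// distrC (lt_trans yx').
  by rewrite rf//= (lt_trans xx')// ltr_pdivrMr// ltr_pMr// ltr1n.
exists (d / 2); first by rewrite divr_gt0.
move=> x y Kx yx; apply: (H (d / 2)) Kx _ yx.
  by rewrite /= sub0r normrN gtr0_norm ?divr_gt0// gtr_pMr// invf_lt1// ltr1n.
by rewrite divr_gt0.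
Qed.

Lemma is_deriveP (R : realType) (V W : normedModType R) (f : V -> W) x v l :
  is_derive x v f l <->
  h^-1 *: (f (h *: v + x) - f x) @[h --> 0^'] --> l.
Proof.
split=> [[/= dx <-]//|fl]; split; first by apply/cvg_ex; exists l.
exact: cvg_lim fl.
Qed.

Lemma is_derive_mxP (R : realType) (V : normedModType R) m n
    (f : V -> 'M[R]_(m, n)) x v l :
  is_derive x v f l <-> forall i j, is_derive x v (fun y => f y i j) (l i j).
Proof.
split=> [/is_deriveP/cvg_mxP fl i j|fl].
  apply/is_deriveP; have := fl i j.
  by under eq_fun do rewrite !mxE.
apply/is_deriveP/cvg_mxP => i j; have /is_deriveP := fl i j.
by under [in X in _ -> X]eq_fun do rewrite !mxE.
Qed.

Lemma is_derive_curve (R : realType) (V W : normedModType R) (f : V -> W)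
    (g : R -> V) (x : R) (dg : V) :
  differentiable f (g x) -> is_derive x 1 g dg ->
  is_derive x 1 (f \o g) ('d f (g x) dg).
Proof.
move=> df [dgx <-]; have gx : differentiable g x by apply/derivable1_diffP.
have dfg : differentiable (f \o g) x by exact: differentiable_comp.
split; first exact/derivable1_diffP.
by rewrite (deriveE _ dfg) (deriveE _ gx) (diff_comp gx df).
Qed.

Lemma is_derive1_continuous (R : realType) (W : normedModType R) (f : R -> W)
    (x : R) (l : W) : is_derive x 1 f l -> {for x, continuous f}.
Proof. by move=> [/derivable1_diffP/differentiable_continuous]. Qed.

Lemma cvg_nbhs_normP (R : realType) (V W : normedModType R) (f : V -> W) x l :
  f y @[y --> x] --> l <-> forall e : R, 0 < e -> exists2 r : R, 0 < r &
    forall y, `|y - x| < r -> `|f y - l| <= e.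
Proof.
split=> [/cvgrPdist_le fl e /fl /nbhs_normP[r /= r0 Hr]|fl].
  by exists r => // y yx; rewrite distrC; apply: Hr; rewrite /= distrC.
apply/cvgrPdist_le => e /fl[r r0 Hr]; apply/nbhs_normP; exists r => // y /=.
by rewrite distrC => /Hr; rewrite distrC.
Qed.

Lemma is_derive_bound (R : realType) (W : normedModType R) (f : R -> W)
    (x : R) (l : W) (e : R) : is_derive x 1 f l -> 0 < e ->
  exists2 r : R, 0 < r & forall y : R, `|y - x| < r ->
    `|f y - f x - (y - x) *: l| <= e * `|y - x|.
Proof.
move=> /is_deriveP/cvgrPdist_le fl /fl; rewrite near_withinE => /nbhs_normP[r r0 Hr].
exists r => // y yx; have [->|yx0] := eqVneq y x.
  by rewrite !subrr scale0r subrr !normr0 mulr0.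
have := Hr (y - x); rewrite /= sub0r normrN subr_eq0 => /(_ yx yx0).
rewrite [_%:A]mulr1 subrK distrC => H.
have -> : f y - f x - (y - x) *: l =
    (y - x) *: ((y - x)^-1 *: (f y - f x) - l).
  by rewrite scalerBr scalerA divff ?subr_eq0// scale1r.
by rewrite normrZ mulrC ler_wpM2r.
Qed.

Lemma cvg_pair_norm (R : realType) (T : Type) (F : set_system T) {FF : Filter F}
    (V W : normedModType R) (f : T -> V) (g : T -> W) (a : V) (b : W) :
  f x @[x --> F] --> a -> g x @[x --> F] --> b ->
  (f x, g x) @[x --> F] --> (a, b).
Proof.
move=> /cvgrPdist_le fa /cvgrPdist_le gb.
apply/(@cvgrPdist_le _ (V * W)%type) => e e0; near=> x.
rewrite prod_normE ge_max /=; apply/andP; split; near: x.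
  exact: fa.
exact: gb.
Unshelve. all: by end_near. Qed.

(** * Gronwall inequality *)

(** With the integrating factor [w], the function [h s = w s * g s - e * (s - a)] has derivative at
    most [(w s - 1) * e], which is nonpositive because [w <= 1] to the right of [a]. *)
Lemma gronwall_scalar (R : realType) (g dg : R -> R) (a b c e : R) :
  a <= b -> 0 <= e -> 0 <= c -> (forall s : R, is_derive s 1 g (dg s)) ->
  (forall s : R, a < s < b -> dg s <= c * g s + e) ->
  g b <= expR (c * (b - a)) * (g a + e * (b - a)).
Proof.
move=> ab e0 c0 dgP dgle.
pose w s := expR (- c * (s - a)).
have dw (s : R) : is_derive s 1 w (- c * w s).
  have dl : is_derive s 1 (fun t : R => - c * (t - a)) (- c).
    have -> : (fun t : R => - c * (t - a)) = (- c) \*: (id - cst a) by [].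
    by apply: is_derive_eq; rewrite subr0 -[RHS]mulr1.
  have -> : w = expR \o (fun t : R => - c * (t - a)) by [].
  have := @is_derive1_comp _ expR _ s _ _ (is_derive_expR _) dl.
  by rewrite mulrC.
pose h : R -> R := w * g - e \*: (id - cst a).
have dh (s : R) : is_derive s 1 h (w s * dg s + g s * (- c * w s) - e).
  by apply: is_derive_eq; rewrite subr0 /GRing.scale/= mulr1.
have hc : {within `[a, b], continuous h}.
  by apply: continuous_subspaceT => s; exact: (is_derive1_continuous (dh s)).
have [s sab hab] := MVT_segment ab (fun s _ => dh s) hc.
have hle : h b <= h a.
  apply: (@ler0_derive1_le_cc _ h a b) => //; rewrite ?in_itv/= ?lexx ?ab//.
    move=> t /[!in_itv]/= tab; have [_ _] := dh t.
    rewrite derive1E; have := dgle t tab; have [dht ->] := dh t => dgt.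
    have /andP[at_ _] := tab.
    have w1 : w t <= 1.
      by rewrite -expR0 ler_expR mulNr oppr_le0 mulr_ge0// subr_ge0 ltW.
    have w0 : 0 < w t by rewrite expR_gt0.
    have := ler_wpM2l (ltW w0) dgt; nra.
move: hle; rewrite /h !fctE /= /GRing.scale /= subrr mulr0 subr0.
rewrite {2}/w subrr mulr0 expR0 mul1r lerBlDr => hle.
rewrite -ler_pdivrMl ?expR_gt0// -expRN -mulNr.
exact: hle.
Qed.

Lemma sqr_norm_le_sum (R : realType) d (v : 'rV[R]_d) :
  `|v| ^+ 2 <= \sum_j v 0 j ^+ 2.
Proof.
have [->|/eqP v0] := eqVneq v 0.
  by rewrite normr0 expr0n sumr_ge0// => j _; exact: sqr_ge0.
have [[i j] vE] : exists ij, `|v| = `|v ij.1 ij.2|.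
  by apply: mx_norm_neq0; apply/eqP => /mx_norm_eq0.
rewrite vE/= ord1 -normrX ger0_norm ?sqr_ge0// (bigD1 j)//= lerDl.
by apply: sumr_ge0 => k _; exact: sqr_ge0.
Qed.

Lemma sum_sqr_le_norm (R : realType) d (v : 'rV[R]_d) :
  \sum_j v 0 j ^+ 2 <= d%:R * `|v| ^+ 2.
Proof.
rewrite (@le_trans _ _ (\sum_(j < d) `|v| ^+ 2))//.
  by apply: ler_sum => j _; rewrite -[leLHS]ger0_norm ?sqr_ge0// normrX
    lerXn2r ?nnegrE// ler_coord_norm.
by rewrite sumr_const card_ord mulr_natl.
Qed.

(** The sup norm is not differentiable, so the scalar inequality is applied to the sum of squares of
    the coordinates, at the cost of factors [d]. [K] depends only on [d], [L] and [T], which is the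
    source of all later uniformity. *)
Lemma gronwall_vec (R : realType) d (L T : R) : 0 <= L -> 0 < T ->
  exists2 K : R, 0 < K & forall (y dy : R -> 'rV[R]_d) (a b e : R),
    (forall s : R, is_derive s 1 y (dy s)) -> a <= b -> b - a <= T -> 0 <= e ->
    (forall s : R, a < s < b -> `|dy s| <= L * `|y s| + e) ->
    `|y b| <= K * (`|y a| + e).
Proof.
(* From [2 y y' <= y^2 + y'^2] in each coordinate and [d (L |y| + e)^2 <= 2 d L^2 g + 2 d e^2] comes
   [g' <= c g + 2 d e^2]. *)
move=> L0 T0; pose c : R := 1 + 2 * d%:R * L ^+ 2.
have c0 : 0 <= c by rewrite addr_ge0// !mulr_ge0// sqr_ge0.
(* [d] bounds [g a] by [|y a|^2], [2 d T] comes from the error term, and [+ 1] keeps [Q] positive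
   when [d = 0]. *)
pose Q : R := expR (c * T) * (d%:R + 2 * d%:R * T + 1).
have Q0 : 0 < Q.
  by rewrite mulr_gt0 ?expR_gt0// ltr_wpDl// addr_ge0// !mulr_ge0// ltW.
exists (Num.sqrt Q) => [|y dy a b e dyP ab bT e0 yle]; first by rewrite sqrtr_gt0.
pose g s := \sum_j y s 0 j ^+ 2.
pose dg s := \sum_j 2 * (y s 0 j * dy s 0 j).
have dgP (s : R) : is_derive s 1 g (dg s).
  have -> : g = \sum_j (fun t => y t 0 j) ^+ 2.
    by apply/funext => t; rewrite fct_sumE.
  apply: is_derive_sum => j; have /is_derive_mxP/(_ 0 j) dj := dyP s.
  by apply: is_derive_eq; rewrite /GRing.scale/= expr1 mulrA.
have dgle (s : R) : a < s < b -> dg s <= c * g s + 2 * d%:R * e ^+ 2.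
  move=> sab; have {}yle := yle _ sab.
  apply: (@le_trans _ _ (\sum_j (y s 0 j ^+ 2 + dy s 0 j ^+ 2))).
    by apply: ler_sum => j _; have := sqr_ge0 (y s 0 j - dy s 0 j); nra.
  rewrite big_split/= -/(g s).
  have dyle := le_trans (sum_sqr_le_norm (dy s)) (_ : _ <= d%:R * (L * `|y s| + e) ^+ 2).
  rewrite (le_trans (lerD (lexx _) (dyle _)))//.
    by rewrite ler_wpM2l// lerXn2r ?nnegrE ?addr_ge0 ?mulr_ge0.
  have yg := sqr_norm_le_sum (y s).
  have : (L * `|y s| + e) ^+ 2 <= 2 * L ^+ 2 * g s + 2 * e ^+ 2.
    apply: (@le_trans _ _ (2 * L ^+ 2 * `|y s| ^+ 2 + 2 * e ^+ 2)).
      by have := sqr_ge0 (L * `|y s| - e); nra.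
    by rewrite lerD2r ler_wpM2l// mulr_ge0// sqr_ge0.
  move=> /(ler_wpM2l (ler0n R d)); rewrite /c; nra.
have e2 : 0 <= 2 * d%:R * e ^+ 2 by rewrite !mulr_ge0// sqr_ge0.
have gb := gronwall_scalar ab e2 c0 dgP dgle.
have yeK : 0 <= `|y a| + e by rewrite addr_ge0.
rewrite -(@ler_pXn2r _ 2)// ?nnegrE ?mulr_ge0 ?sqrtr_ge0//.
rewrite exprMn sqr_sqrtr ?(ltW Q0)//.
apply: le_trans (sqr_norm_le_sum _) _; apply: le_trans gb _.
rewrite /Q -[leRHS]mulrA ler_pM ?expR_ge0//.
- by rewrite addr_ge0 ?mulr_ge0 ?subr_ge0// sumr_ge0// => j _; exact: sqr_ge0.
- by rewrite ler_expR ler_wpM2l.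
have ga := sum_sqr_le_norm (y a).
apply: le_trans (lerD ga (ler_wpM2l e2 bT)) _.
have d0 : 0 <= d%:R :> R by [].
have y2 : `|y a| ^+ 2 <= (`|y a| + e) ^+ 2.
  by rewrite lerXn2r ?nnegrE// lerDl.
have e2' : e ^+ 2 <= (`|y a| + e) ^+ 2 by rewrite lerXn2r ?nnegrE// lerDr.
have := ler_wpM2l d0 y2; have := ler_wpM2l (mulr_ge0 d0 (ltW T0)) e2'.
have := sqr_ge0 (`|y a| + e); nra.
Qed.

(** Continuity argument: before [|y|] first reaches [r] the differential inequality holds, so
    [gronwall_vec] bounds [|y|] up to that time by a quantity strictly below [r], a
    contradiction. *)
Lemma gronwall_forward (R : realType) d (L T : R) : 0 <= L -> 0 < T ->
  exists2 K : R, 0 < K & forall (y dy : R -> 'rV[R]_d) (a b e r : R),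
    (forall s : R, is_derive s 1 y (dy s)) -> a <= b -> b - a <= T -> 0 <= e ->
    (forall s : R, a < s < b -> `|y s| < r -> `|dy s| <= L * `|y s| + e) ->
    K * (`|y a| + e) < r -> `|y b| <= K * (`|y a| + e).
Proof.
move=> L0 T0; have [K0 K00 H] := gronwall_vec d L0 T0.
exists (K0 + 1); first by rewrite addr_gt0.
move=> y dy a b e r dyP ab bT e0 yle Kr.
have ye0 : 0 <= `|y a| + e by rewrite addr_ge0.
have K0r : K0 * (`|y a| + e) < r.
  by apply: le_lt_trans Kr; rewrite ler_wpM2r// lerDl.
have yar : `|y a| < r.
  apply: le_lt_trans Kr; rewrite mulrDl mul1r.
  by rewrite (le_trans _ (_ : `|y a| + e <= _))// ?lerDl// lerDr mulr_ge0// ltW.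
have yc : continuous (fun s => `|y s|).
  move=> s; apply: (@continuous_comp _ _ _ y) (@norm_continuous _ _ _).
  exact: is_derive1_continuous (dyP s).
suff yr (s : R) : a <= s <= b -> `|y s| < r.
  apply: le_trans (_ : _ <= K0 * (`|y a| + e)) _; last first.
    by rewrite ler_wpM2r// lerDl.
  apply: (H y dy) => // s sab; apply: yle => //; apply: yr.
  by case/andP: sab => as_ sb; rewrite !ltW.
move=> sab; rewrite ltNge; apply/negP => rs.
pose A := `[a, b]%classic `&` [set t | r <= `|y t|].
have A0 : A !=set0 by exists s; split => //=; rewrite in_itv.
have Ac : compact A.
  apply: (@subclosed_compact _ _ `[a, b]%classic); [|exact: segment_compact|by move=> ? []].
  apply: closedI; first exact: itv_closed.
  exact: (closed_comp (fun t _ => yc t) (@closed_ge _ r)).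
(* [t] is the first time at which [`|y|] reaches [r]. *)
have [t] := compact_EVT_min A0 Ac (continuous_subspaceT (fun t => cvg_id)).
rewrite inE => -[/= tab rt] tmin.
move: tab; rewrite in_itv/= => /andP[at_ tb].
suff : `|y t| <= K0 * (`|y a| + e) by move=> /le_lt_trans/(_ K0r); rewrite ltNge rt.
apply: (H y dy) => //; first by rewrite (le_trans _ bT)// lerD2r.
move=> q /andP[aq qt]; apply: yle; first by rewrite aq (lt_le_trans qt).
rewrite ltNge; apply/negP => rq.
have : t <= q; last by rewrite leNgt qt.
by apply: tmin; rewrite inE; split => //=; rewrite in_itv/= (ltW aq) (le_trans (ltW qt)).
Qed.

(* The radius [r] serves to bootstrap: the differential inequality is only
   required as long as [`|y s| < r]. *)
Lemma gronwall (R : realType) d (L T : R) : 0 <= L -> 0 < T ->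
  exists2 K : R, 0 < K & forall (y dy : R -> 'rV[R]_d) (a b e r : R),
    (forall s : R, is_derive s 1 y (dy s)) -> `|a| <= T -> `|b| <= T -> 0 <= e ->
    (forall s : R, `|s| <= T -> `|y s| < r -> `|dy s| <= L * `|y s| + e) ->
    K * (`|y a| + e) < r -> `|y b| <= K * (`|y a| + e).
Proof.
(* Two times of [[- T, T]] are at most [T + T] apart. *)
move=> L0 T0; have [|K K0 H] := @gronwall_forward _ d L (T + T) L0; first by rewrite addr_gt0.
exists K => // y dy a b e r dyP aT bT e0 yle Kr.
have bnd (x z : R) : `|x| <= T -> `|z| <= T -> x - z <= T + T.
  by move=> xT zT; rewrite (le_trans (ler_norm _))// (le_trans (ler_normB _ _))// lerD.
have inT (x z s : R) : `|x| <= T -> `|z| <= T -> x < s < z -> `|s| <= T.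
  rewrite !ler_norml => /andP[xT _] /andP[_ zT] /andP[xs sz].
  by rewrite (le_trans xT (ltW xs)) (le_trans (ltW sz) zT).
have [ab|/ltW ba] := leP a b.
  by apply: (H y dy) Kr => //; [exact: bnd|move=> s /inT sT; apply: yle; exact: sT].
(* For [b < a] time is reversed: [y (- s)] satisfies the same inequality from [- a] to [- b]. *)
have dyN (s : R) : is_derive s 1 (y \o -%R) (- dy (- s)).
  have := is_derive_curve (_ : differentiable y (- s)) (is_deriveNid s 1).
  have [/derivable1_diffP dys <-] := dyP (- s).
  by move=> /(_ dys); rewrite linearN /= -(deriveE _ dys).
have := H (y \o -%R) (fun s => - dy (- s)) (- a) (- b) e r dyN.
rewrite /= !opprK; apply => //; first by rewrite lerN2.
  by rewrite addrC; exact: bnd.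
move=> s /inT; rewrite !normrN => /(_ aT bT) sT sr.
by apply: yle => //; rewrite normrN.
Qed.

(** * The velocity field *)

Lemma is_derive_line (R : realType) (V : normedModType R) (p w : V) (x : R) :
  is_derive x 1 (fun t : R => p + t *: w) w.
Proof.
have -> : (fun t : R => p + t *: w) = cst p + *:%R^~ w by [].
have dw : is_derive x 1 ( *:%R^~ w) w.
  have [ds dsE] := is_diff_scalel x w.
  split; first exact/derivable1_diffP.
  by rewrite (deriveE _ ds) dsE scale1r.
by apply: is_derive_eq; rewrite add0r.
Qed.

Lemma row_sum_basis (R : realType) d (v : 'rV[R]_d) :
  v = \sum_k v 0 k *: basis_vec k.
Proof. exact: row_sum_delta. Qed.

(** Space derivatives only. Vectors are rows and multiply on the left, so this is the transpose of
    the usual Jacobian matrix. *)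
Definition velocity_jac (R : realType) d (u : 'rV[R]_d -> R -> 'rV[R]_d)
    (q : 'rV[R]_d * R) : 'M[R]_d :=
  \matrix_(k, j) ('d (fun q => u q.1 q.2) q (basis_vec k, 0)) 0 j.

Section Velocity.
Context {R : realType} {d : nat}.
Variable u : 'rV[R]_d -> R -> 'rV[R]_d.
Hypothesis hu : C1_velocity u.
Local Notation A := (velocity_jac u).

Lemma velocity_jacE q v : v *m A q = 'd (fun q => u q.1 q.2) q (v, 0).
Proof.
have -> : (v, 0 : R) = \sum_k v 0 k *: ((basis_vec k, 0) : 'rV[R]_d * R).
  rewrite [RHS]surjective_pairing (raddf_sum fst) (raddf_sum snd)/=.
  congr (_, _); first exact: row_sum_basis.
  by rewrite big1// => k _; rewrite scaler0.
rewrite linear_sum; apply/rowP => j; rewrite mxE summxE.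
by apply: eq_bigr => k _; rewrite linearZ !mxE.
Qed.

Lemma velocity_jac_continuous : continuous A.
Proof.
move=> q; apply: (@cvg_mxP R _ (nbhs q) _ d d A (A q)).2 => k j.
rewrite [X in _ --> X]mxE.
have -> : (fun x => A x k j) =
    fun x => ('d (fun q => u q.1 q.2) x (basis_vec k, 0)) 0 j.
  by apply/funext => x; rewrite mxE.
have := hu.2 (basis_vec k, 0) q.
by move=> /cvg_mxP/(_ 0 j).
Qed.

(** The mean value theorem fails for vector-valued functions, so it is applied to one coordinate at
    a time and [c] depends on [j]. *)
Lemma velocity_MVT (x y : 'rV[R]_d) (s : R) j : exists2 c : R, 0 <= c <= 1 &
  (u y s - u x s) 0 j = ((y - x) *m A (x + c *: (y - x), s)) 0 j.
Proof.
pose g (c : R) : 'rV[R]_d * R := (x, s) + c *: (y - x, 0).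
have gE c : g c = (x + c *: (y - x), s).
  by apply/eqP; rewrite xpair_eqE/= scaler0 addr0 !eqxx.
pose f (c : R) := u (g c).1 (g c).2.
have df (c : R) : is_derive c 1 f ((y - x) *m A (g c)).
  rewrite velocity_jacE; apply: (is_derive_curve (hu.1 (g c))).
  exact: is_derive_line.
have dfj (c : R) : is_derive c 1 (fun c => f c 0 j) (((y - x) *m A (g c)) 0 j).
  by have /is_derive_mxP := df c.
have [|c] := MVT_segment (@ler01 R) (fun c _ => dfj c).
  by apply: continuous_subspaceT => c; exact: (is_derive1_continuous (dfj c)).
rewrite in_itv/= => c01; rewrite subr0 mulr1 /f !gE/= scale1r scale0r addr0.
by rewrite [x + _]addrC subrK => Ec; exists c; rewrite // -Ec !mxE.
Qed.

Lemma box_compact (M T : R) :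
  compact [set q : 'rV[R]_d * R | `|q.1| <= M /\ `|q.2| <= T].
Proof.
have -> : [set q : 'rV[R]_d * R | `|q.1| <= M /\ `|q.2| <= T] =
    [set x | `|x| <= M] `*` `[- T, T].
  by apply/seteqP; split => -[x s] /=; rewrite in_itv/= ler_norml.
apply: compact_setX; last exact: segment_compact.
apply: bounded_closed_compact.
  by exists M; split; [exact: num_real|move=> N /ltW MN x /= /le_trans; apply].
exact: (closed_comp (fun x _ => @norm_continuous _ _ x) (@closed_le _ M)).
Qed.

Lemma velocity_jac_bounded (M T : R) : exists2 L, 0 <= L &
  forall (x : 'rV[R]_d) (s : R), `|x| <= M -> `|s| <= T ->
    forall v : 'rV[R]_d, `|v *m A (x, s)| <= L * `|v|.
Proof.
have : compact (A @` [set q | `|q.1| <= M /\ `|q.2| <= T]).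
  apply: continuous_compact; last exact: box_compact.
  exact/continuous_subspaceT/velocity_jac_continuous.
move=> /compact_bounded[B [_ HB]].
exists (d%:R * (`|B| + 1)); first by rewrite mulr_ge0// addr_ge0.
move=> x s xM sT v; rewrite (le_trans (ler_norm_mulmx _ _))//.
rewrite mulrAC ler_wpM2r// ler_wpM2l//; apply: HB; last by exists (x, s).
by rewrite (le_lt_trans (ler_norm B))// ltrDl.
Qed.

Let norm_segment (x y : 'rV[R]_d) (c M : R) :
  `|x| <= M -> `|y| <= M -> 0 <= c <= 1 -> `|x + c *: (y - x)| <= M.
Proof.
move=> xM yM /andP[c0 c1].
have -> : x + c *: (y - x) = (1 - c) *: x + c *: y.
  by rewrite scalerBr scalerBl scale1r addrAC addrA.
rewrite (le_trans (ler_normD _ _))// !normrZ !ger0_norm ?subr_ge0//.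
rewrite (_ : M = (1 - c) * M + c * M); last by rewrite -mulrDl subrK mul1r.
by rewrite lerD// ler_wpM2l// subr_ge0.
Qed.

Lemma velocity_lipschitz (M T : R) : exists2 L, 0 <= L &
  forall (x y : 'rV[R]_d) (s : R), `|x| <= M -> `|y| <= M -> `|s| <= T ->
    `|u y s - u x s| <= L * `|y - x|.
Proof.
have [L L0 HL] := velocity_jac_bounded M T; exists L => // x y s xM yM sT.
apply: mx_norm_le => [|i j]; first by rewrite mulr_ge0.
rewrite ord1; have [c c01 ->] := velocity_MVT x y s j.
by rewrite (le_trans (ler_coord_norm _ _ _))// HL// norm_segment.
Qed.

(** The mean value point lies within [|y - x|] of [x], so the matrix there differs little from
    [A (x, s)], uniformly over the compact box. *)
Lemma velocity_taylor (M T e : R) : 0 < e -> exists2 r : R, 0 < r &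
  forall (x y : 'rV[R]_d) (s : R), `|x| <= M -> `|s| <= T -> `|y - x| < r ->
    `|u y s - u x s - (y - x) *m A (x, s)| <= e * `|y - x|.
Proof.
(* [ler_norm_mulmx] costs a factor [d]; [d.+1] keeps the quotient positive when [d = 0]. *)
move=> e0; have e'0 : 0 < e / d.+1%:R by rewrite divr_gt0.
have [r r0 Hr] := compact_near_uniform (@box_compact M T) velocity_jac_continuous e'0.
exists r => // x y s xM sT xyr.
apply: mx_norm_le => [|i j]; first by rewrite mulr_ge0// ltW.
rewrite ord1 mxE; have [c /andP[c0 c1] ->] := velocity_MVT x y s j.
have -> : ((y - x) *m A (x + c *: (y - x), s)) 0 j +
    (- ((y - x) *m A (x, s))) 0 j =
    ((y - x) *m (A (x + c *: (y - x), s) - A (x, s))) 0 j.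
  by rewrite mulmxBr !mxE.
rewrite (le_trans (ler_coord_norm _ _ _))// (le_trans (ler_norm_mulmx _ _))//.
have := Hr (x, s) (x + c *: (y - x), s).
rewrite prod_normE/= => /(_ (conj xM sT)).
rewrite subrr normr0 [x + _]addrC addrK normrZ ger0_norm// => Ae.
rewrite mulrAC ler_wpM2r//.
rewrite (le_trans (ler_wpM2l _ (Ae _)))//.
  by rewrite gt_max r0 (le_lt_trans _ xyr)// ler_piMl.
rewrite mulrCA ger_pMr// ler_pdivrMr//.
by rewrite mul1r ler_nat.
Qed.

End Velocity.

(** * Trajectories *)

(** The final time [s] is absolute, whereas [phi] takes the elapsed time; the flow law then needs no
    time arithmetic. The [F (t, p)] of the overview is [position phi t p t0]. *)
Definition position (R : realType) d (phi : R -> R -> 'rV[R]_d -> 'rV[R]_d)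
    (t : R) (p : 'rV[R]_d) (s : R) : 'rV[R]_d := phi t (s - t) p.

(** Solutions of the linear equation [y' = y B] up to a defect [e] on [[- T, T]]. They are stable
    under linear combinations, the defects combining accordingly, which suits difference
    quotients. *)
Definition approx_linear (R : realType) d (T : R) (B : R -> 'M[R]_d)
    (y : R -> 'rV[R]_d) (e : R) : Prop :=
  exists dy : R -> 'rV[R]_d, forall s : R,
    is_derive s 1 y (dy s) /\ (`|s| <= T -> `|dy s - y s *m B s| <= e).

Section ApproxLinear.
Context {R : realType} {d : nat}.
Variables (T : R) (B : R -> 'M[R]_d).
Local Notation approx := (approx_linear T B).

Lemma approx_linear0 : approx 0 0.
Proof.
exists 0 => s; split => [|_]; first exact: is_derive_cst.
by rewrite mul0mx subrr normr0.
Qed.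

Lemma approx_linearD y z e f : approx y e -> approx z f -> approx (y + z) (e + f).
Proof.
move=> [dy Hy] [dz Hz]; exists (dy + dz) => s; split.
  by have [? _] := Hy s; have [? _] := Hz s; exact: is_deriveD.
move=> sT; rewrite -[(y + z) s]/(y s + z s) -[(dy + dz) s]/(dy s + dz s).
rewrite mulmxDl opprD addrACA (le_trans (ler_normD _ _))//.
by rewrite lerD ?(Hy s).2 ?(Hz s).2.
Qed.

Lemma approx_linearZ c y e : approx y e -> approx (c \*: y) (`|c| * e).
Proof.
move=> [dy Hy]; exists (c \*: dy) => s; split.
  by have [? _] := Hy s; exact: is_deriveZ.
by move=> sT; rewrite /= -scalemxAl -scalerBr normrZ ler_wpM2l// (Hy s).2.
Qed.

Lemma approx_linear_sum n (y : 'I_n -> R -> 'rV[R]_d) (e : 'I_n -> R) :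
  (forall k, approx (y k) (e k)) -> approx (\sum_k y k) (\sum_k e k).
Proof.
by move=> H; elim/big_ind2: _ => // [|? ? ? ?]; [exact: approx_linear0|exact: approx_linearD].
Qed.

End ApproxLinear.

Lemma approx_linear_bound (R : realType) d (L T : R) : 0 <= L -> 0 < T ->
  exists2 K : R, 0 < K & forall (B : R -> 'M[R]_d) y e (t s : R),
    (forall (q : R) (v : 'rV[R]_d), `|q| <= T -> `|v *m B q| <= L * `|v|) ->
    approx_linear T B y e -> 0 <= e -> `|t| <= T -> `|s| <= T ->
    `|y s| <= K * (`|y t| + e).
Proof.
move=> L0 T0; have [K K0 H] := gronwall d L0 T0; exists K => //.
move=> B y e t s BL [dy Hy] e0 tT sT.
(* The inequality on [dy] holds whatever the size of [y], so any radius beyond the target bound will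
   do. *)
apply: (H y dy _ _ _ (K * (`|y t| + e) + 1)) => // [q|q qT _|].
- by case: (Hy q).
- rewrite -(subrK (y q *m B q) (dy q)) addrC (le_trans (ler_normD _ _))//.
  by rewrite lerD ?BL// (Hy q).2.
- by rewrite ltrDl.
Qed.

Section Flow.
Context {R : realType} {d : nat}.
Variables (u : 'rV[R]_d -> R -> 'rV[R]_d) (phi : R -> R -> 'rV[R]_d -> 'rV[R]_d).
Hypotheses (hu : C1_velocity u) (hwp : well_posed u) (hphi : is_flow_map u phi).
Local Notation X := (position phi).
Local Notation A := (velocity_jac u).
Local Notation V := 'rV[R]_d.

Lemma position_ode t p : ode_solution u t p (X t p).
Proof.
have [x [xP _]] := hwp t p.
suff -> : X t p = x by [].
by apply/funext => s; rewrite /position (hphi xP) addrC subrK.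
Qed.

Lemma position_id t p : X t p t = p.
Proof. by case: (position_ode t p). Qed.

Lemma position_derive t p (s : R) : is_derive s 1 (X t p) (u (X t p s) s).
Proof. by case: (position_ode t p). Qed.

Lemma position_continuous1 t p : continuous (X t p).
Proof. by move=> s; exact: is_derive1_continuous (position_derive t p s). Qed.

(** Both sides solve the equation and agree at time [r], so uniqueness identifies them. *)
Lemma position_trans r t p s : X r (X t p r) s = X t p s.
Proof.
have [x [_ xU]] := hwp r (X t p r).
rewrite -(xU _ (position_ode r _)) (xU (X t p))//.
by split=> // q; exact: position_derive.
Qed.

Lemma position_diff_derive t p r q (s : R) :
  is_derive s 1 (X r q - X t p) (u (X r q s) s - u (X t p s) s).
Proof. exact: is_deriveB (position_derive _ _ _) (position_derive _ _ _). Qed.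

Definition traj_bounded (T M t : R) (p : V) :=
  `|t| <= T /\ forall s : R, `|s| <= T -> `|X t p s| <= M.

(** If [M] bounds the given trajectory on [[- T, T]], then [u] is Lipschitz on the ball of radius
    [M + 1], and bootstrapping with radius [1] in [gronwall] keeps nearby trajectories within
    distance [1] of it. *)
Lemma traj_bounded_near (T t : R) (p : V) : `|t| < T -> exists M,
  exists2 r : R, 0 < r & forall (t' : R) (p' : V),
    `|t' - t| < r -> `|p' - p| < r -> traj_bounded T M t' p'.
Proof.
move=> tT; have T0 : 0 < T by apply: le_lt_trans tT.
have nX : continuous (fun s => `|X t p s|).
  move=> s; apply: (@continuous_comp _ _ _ (X t p)) (@norm_continuous _ _ _).
  exact: position_continuous1.
have [||c _ cmax] := @EVT_max _ (fun s => `|X t p s|) (- T) T.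
- by rewrite (le_trans _ (ltW T0))// oppr_le0 ltW.
- exact: continuous_subspaceT.
set M := `|X t p c| in cmax.
have XM (s : R) : `|s| <= T -> `|X t p s| <= M.
  by rewrite ler_norml => sT; apply: cmax; rewrite in_itv.
have [L L0 HL] := velocity_lipschitz hu (M + 1) T.
have [K K0 HK] := gronwall d L0 T0.
have k0 : 0 < (2 * K)^-1 by rewrite invr_gt0 mulr_gt0.
have : X t p s @[s --> t] --> X t p t by exact: position_continuous1.
move=> /cvgrPdist_lt/(_ _ k0)/nbhs_normP[r1 /= r10 Hr1].
(* [T - |t|] keeps [t'] in [[- T, T]]. The other two bounds make [|X t p t' - p|] and [|p' - p|]
   less than half of [K^-1], so that at time [t'] the two trajectories are less than [K^-1]
   apart. *)
exists (M + 1), (Num.min r1 (Num.min (T - `|t|) (2 * K)^-1)).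
  by rewrite !lt_min r10 k0 subr_gt0 tT.
move=> t' p'; rewrite !lt_min => /and3P[tr1 tT' _] /and3P[_ _ pk].
have t'T : `|t'| <= T.
  by rewrite -(subrK t t') (le_trans (ler_normD _ _))// -lerBrDr ltW.
split=> // s sT.
rewrite -(subrK (X t p s) (X t' p' s)) (le_trans (ler_normD _ _))// addrC.
rewrite lerD ?XM//.
have Kr : K * (`|X t' p' t' - X t p t'| + 0) < 1.
  rewrite addr0 -ltr_pdivlMl// mulr1 position_id -(subrKA p).
  rewrite (le_lt_trans (ler_normD _ _))//.
  have -> : K^-1 = (2 * K)^-1 + (2 * K)^-1 by field; rewrite gt_eqF.
  rewrite ltrD//; have := Hr1 t'; rewrite /= distrC position_id; exact.
have := HK (X t' p' - X t p) (fun q => u (X t' p' q) q - u (X t p q) q) t' s 0 1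
  (position_diff_derive _ _ _ _) t'T sT (lexx _) _ Kr.
move=> H; apply: le_trans (H _) (ltW Kr) => q qT q1.
rewrite addr0; apply: HL => //; first by rewrite (le_trans (XM _ qT))// lerDl.
rewrite -(subrK (X t p q) (X t' p' q)) (le_trans (ler_normD _ _))// addrC.
by rewrite lerD ?XM// ltW.
Qed.

Lemma position_lipschitz (T M : R) : 0 < T -> exists2 K : R, 0 < K &
  forall (t : R) p q, traj_bounded T M t p -> traj_bounded T M t q ->
    forall s : R, `|s| <= T ->
    `|X t q s - X t p s| <= K * `|q - p|.
Proof.
move=> T0; have [L L0 HL] := velocity_lipschitz hu M T.
have [K K0 HK] := gronwall d L0 T0; exists K => // t p q [tT pM] [_ qM] s sT.
have := HK (X t q - X t p) _ t s 0 _ (position_diff_derive _ _ _ _) tT sT (lexx _).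
rewrite addr0 -![(_ - _ : _ -> _) _]/(_ - _) !position_id => /(_ (K * `|q - p| + 1)).
by apply; [move=> r rT _; rewrite addr0; apply: HL; rewrite ?pM ?qM|rewrite ltrDl].
Qed.

Lemma position_variation (T M e : R) : 0 < T -> 0 < e -> exists2 r : R, 0 < r &
  forall (t : R) p q, traj_bounded T M t p -> traj_bounded T M t q ->
    `|q - p| < r ->
    approx_linear T (fun s => A (X t p s, s)) (X t q - X t p) (e * `|q - p|).
Proof.
move=> T0 e0; have [K K0 HK] := position_lipschitz M T0.
(* Taylor's remainder is small relative to the distance at time [s], which is at most [K] times the
   distance [|q - p|] at time [t]. *)
have eK0 : 0 < e / K by rewrite divr_gt0.
have [r r0 Hr] := velocity_taylor hu M T eK0.
exists (r / K); first by rewrite divr_gt0.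
move=> t p q pt qt; rewrite ltr_pdivlMr// mulrC => qpr.
exists (fun s => u (X t q s) s - u (X t p s) s) => s; split.
  exact: position_diff_derive.
move=> sT; have XK := HK t p q pt qt s sT.
have [_ /(_ s sT) pM] := pt.
have := Hr (X t p s) (X t q s) s pM sT (le_lt_trans XK qpr).
move=> /le_trans; apply.
by rewrite (le_trans (ler_wpM2l (ltW eK0) XK))// mulrA divfK// gt_eqF.
Qed.

Lemma variation_bound (T M : R) : 0 < T -> exists2 K : R, 0 < K &
  forall (t : R) p, traj_bounded T M t p -> forall y e, 0 <= e ->
    approx_linear T (fun s => A (X t p s, s)) y e ->
    forall s : R, `|s| <= T -> `|y s| <= K * (`|y t| + e).
Proof.
move=> T0; have [L L0 HL] := velocity_jac_bounded hu M T.
have [K K0 HK] := approx_linear_bound d L0 T0; exists K => //.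
move=> t p [tT pM] y e e0 ye s sT.
by apply: HK ye _ _ _ => // q v qT; apply: HL => //; exact: pM.
Qed.

End Flow.

(** * Differentiability of the flow *)

Lemma norm_basis_vec (R : realType) d (k : 'I_d) : `|basis_vec k : 'rV[R]_d| <= 1.
Proof.
by apply: mx_norm_le => // i j; rewrite mxE; case: (_ && _); rewrite ?normr1 ?normr0.
Qed.

(** [b] is the final time and [t] the initial one; row vectors multiply on the left. These
    directional derivatives exist by [position_derivable]. *)
Definition position_jac (R : realType) d (phi : R -> R -> 'rV[R]_d -> 'rV[R]_d)
    (b t : R) (p : 'rV[R]_d) : 'M[R]_d :=
  \matrix_k 'D_(basis_vec k) (fun p => position phi t p b) p.

Section FlowDifferentiable.
Context {R : realType} {d : nat}.
Variables (u : 'rV[R]_d -> R -> 'rV[R]_d) (phi : R -> R -> 'rV[R]_d -> 'rV[R]_d).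
Hypotheses (hu : C1_velocity u) (hwp : well_posed u) (hphi : is_flow_map u phi).
Local Notation X := (position phi).
Local Notation A := (velocity_jac u).
Local Notation V := 'rV[R]_d.
Local Notation traj_bounded := (traj_bounded phi).
Local Notation J := (position_jac phi).

(** Both quotients solve the same linear equation up to a small defect and both equal [w] at time
    [t]. Their difference thus vanishes at [t] and is controlled by the defects alone. *)
Lemma quotient_cauchy (T M e : R) : 0 < T -> 0 < e -> exists2 r : R, 0 < r &
  forall (t : R) (p w : V) (h h' : R), `|w| <= 1 -> traj_bounded T M t p ->
    traj_bounded T M t (h *: w + p) -> traj_bounded T M t (h' *: w + p) ->
    h != 0 -> h' != 0 -> `|h| < r -> `|h'| < r -> forall s : R, `|s| <= T ->
    `|h^-1 *: (X t (h *: w + p) s - X t p s) -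
      h'^-1 *: (X t (h' *: w + p) s - X t p s)| <= e.
Proof.
move=> T0 e0; have [K K0 HK] := variation_bound phi hu M T0.
(* Two quotients, each of defect at most [e / (2 * K)] once divided by its increment; Gronwall
   multiplies the sum by [K]. *)
have e10 : 0 < e / (2 * K) by rewrite divr_gt0// mulr_gt0.
have [r r0 Hr] := position_variation hu hwp hphi M T0 e10.
exists r => // t p w h h' w1 pt ht h't h0 h'0 hr h'r s sT.
have wr (c : R) : `|c| < r -> `|c *: w + p - p| < r.
  by move=> cr; rewrite addrK normrZ (le_lt_trans _ cr)// ler_piMr.
have := approx_linearD (approx_linearZ h^-1 (Hr t p _ pt ht (wr _ hr)))
  (approx_linearZ (- h'^-1) (Hr t p _ pt h't (wr _ h'r))).
have ce (c : R) : c != 0 ->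
    `|c^-1| * (e / (2 * K) * `|c *: w + p - p|) <= e / (2 * K).
  move=> c0; rewrite addrK normrZ normfV mulrCA mulKf ?normr_eq0//.
  by rewrite ler_piMr// ltW.
set e1 := (X in approx_linear _ _ _ X) => /(HK t p pt) H.
have e1e : e1 <= e / K.
  have -> : e / K = e / (2 * K) + e / (2 * K) by field; rewrite gt_eqF.
  by rewrite lerD ?normrN ?ce.
have := H _ s sT; rewrite /= -![(_ + _ : _ -> _) _]/(_ + _) /=.
rewrite -![(_ - _ : _ -> _) _]/(_ - _) !scaleNr => /(_ _)/le_trans; apply.
  by rewrite /e1 addr_ge0// mulr_ge0// mulr_ge0// ltW.
rewrite !(position_id hwp hphi) !addrK !scalerK// subrr normr0 add0r.
by rewrite -ler_pdivlMl// mulrC.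
Qed.

(** The expression is again an approximate solution vanishing at time [t], where [q - p] is the
    combination of the basis vectors. Keeping [h] finite defers the limit to [position_strict_diff],
    with a radius independent of the base point. *)
Lemma quotient_frechet (T M e : R) : 0 < T -> 0 < e -> exists2 r : R, 0 < r &
  forall (t : R) (p q : V) (h : R),
    traj_bounded T M t p -> traj_bounded T M t q ->
    (forall k, traj_bounded T M t (h *: basis_vec k + p)) ->
    h != 0 -> `|q - p| < r -> `|h| < r -> forall s : R, `|s| <= T ->
    `|X t q s - X t p s - \sum_k (q - p) 0 k *:
      (h^-1 *: (X t (h *: basis_vec k + p) s - X t p s))| <= e * `|q - p|.
Proof.
move=> T0 e0; have [K K0 HK] := variation_bound phi hu M T0.
(* There are [d.+1] defects: one for [q] and one for each basis vector. *)
have e10 : 0 < e / (d.+1%:R * K) by rewrite divr_gt0// mulr_gt0.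
have [r r0 Hr] := position_variation hu hwp hphi M T0 e10.
set e1 := e / _ in e10 Hr.
exists r => // t p q h pt qt ht h0 qr hr s sT.
have kr k : `|h *: basis_vec k + p - p| < r.
  by rewrite addrK normrZ (le_lt_trans _ hr)// ler_piMr// norm_basis_vec.
have := approx_linearD (Hr t p q pt qt qr) (approx_linear_sum (fun k =>
  approx_linearZ (- (q - p) 0 k) (approx_linearZ h^-1 (Hr t p _ pt (ht k) (kr k))))).
set f := (X in approx_linear _ _ _ X).
set y := (X in approx_linear _ _ X) => /(HK t p pt) H.
have fe : f <= e / K * `|q - p|.
  rewrite /f (_ : e / K = e1 + \sum_(k < d) e1); last first.
    rewrite sumr_const card_ord -[e1 in X in X + _]mulr1n -mulrnDr add1n.
    by rewrite -mulr_natl /e1 invfM mulrCA mulVKf// pnatr_eq0.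
  rewrite mulrDl lerD// mulr_suml ler_sum// => k _.
  rewrite normrN addrK normrZ normfV [`|h|^-1 * _]mulrCA mulKf ?normr_eq0//.
  rewrite mulrCA ler_pM2l// (@le_trans _ _ (`|(q - p) 0 k| * 1))//.
    by rewrite ler_wpM2l// norm_basis_vec.
  by rewrite mulr1 ler_coord_norm.
have yE a : y a = X t q a - X t p a - \sum_k (q - p) 0 k *:
    (h^-1 *: (X t (h *: basis_vec k + p) a - X t p a)).
  rewrite /y -[LHS]/(_ + (\sum_k _) a); congr (_ + _).
  by rewrite fct_sumE -sumrN; apply: eq_bigr => k _; rewrite /= scaleNr.
have yt0 : y t = 0.
  rewrite yE !(position_id hwp hphi); apply/eqP; rewrite subr_eq0; apply/eqP.
  rewrite [LHS]row_sum_basis; apply: eq_bigr => k _.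
  by rewrite !(position_id hwp hphi) addrK scalerK.
rewrite -yE (le_trans (H _ s sT))//.
  apply: addr_ge0; first by rewrite mulr_ge0// ltW.
  apply: sumr_ge0 => k _.
  by rewrite mulr_ge0// mulr_ge0// mulr_ge0// ltW.
rewrite yt0 normr0 add0r (le_trans (ler_wpM2l (ltW K0) fe))//.
by rewrite mulrA [K * _]mulrC divfK ?gt_eqF.
Qed.

Let large (t b : R) : exists2 T : R, 0 < T & `|t| < T /\ `|b| <= T.
Proof.
exists (`|t| + `|b| + 1); first by rewrite ltr_wpDl// addr_ge0.
by split; [rewrite -addrA ltrDl ltr_wpDl|rewrite addrAC lerDr].
Qed.

Lemma position_derivable (b t : R) (p w : V) : `|w| <= 1 ->
  derivable (fun p => X t p b) p w.
Proof.
move=> w1; have [T T0 [tT bT]] := large t b.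
have [M [r r0 Hr]] := traj_bounded_near hu hwp hphi p tT.
have tm (h : R) : `|h| < r -> traj_bounded T M t (h *: w + p).
  move=> hr; apply: Hr; first by rewrite subrr normr0.
  by rewrite addrK normrZ (le_lt_trans _ hr)// ler_piMr.
apply: cauchy_cvg; apply: cauchy_exP => e e0.
have [r' r'0 Hr'] := quotient_cauchy M T0 (divr_gt0 e0 (ltr0n _ 2)).
have m0 : 0 < Num.min r r' by rewrite lt_min r0.
(* Any fixed admissible increment serves as the centre in the Cauchy criterion. *)
pose h0 := Num.min r r' / 2.
have h00 : 0 < h0 by rewrite divr_gt0.
have h0m : `|h0| < Num.min r r'.
  by rewrite gtr0_norm// ltr_pdivrMr// ltr_pMr// ltr1n.
exists (h0^-1 *: (X t (h0 *: w + p) b - X t p b)).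
suff : \forall h \near 0^', ball (h0^-1 *: (X t (h0 *: w + p) b - X t p b)) e
    (h^-1 *: (X t (h *: w + p) b - X t p b)) by [].
near=> h; rewrite /= -ball_normE/=.
have hn0 : h != 0 by near: h; exact: nbhs_dnbhs_neq.
have : `|h| < Num.min r r' by near: h; exact: dnbhs0_lt.
move: h0m; rewrite !lt_min => /andP[h0r h0r'] /andP[hr hr'].
apply: le_lt_trans (_ : e / 2 < e); last first.
  by rewrite ltr_pdivrMr// ltr_pMr// ltr1n.
apply: Hr' => //; last by rewrite gt_eqF.
- by have := tm 0; rewrite normr0 scale0r add0r; apply.
- exact: tm.
- exact: tm.
Unshelve. all: by end_near. Qed.

(** Limit of [quotient_frechet] as [h] tends to 0. The base point [(t', p')] varies along with [q'];
    this uniformity later yields the continuity of [J]. *)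
Lemma position_strict_diff (b t : R) (p : V) (e : R) : 0 < e ->
  exists2 r : R, 0 < r & forall (t' : R) (p' q' : V),
    `|t' - t| < r -> `|p' - p| < r -> `|q' - p| < r ->
    `|X t' q' b - X t' p' b - (q' - p') *m J b t' p'| <= e * `|q' - p'|.
Proof.
move=> e0; have [T T0 [tT bT]] := large t b.
have [M [r1 r10 Hr1]] := traj_bounded_near hu hwp hphi p tT.
have [r2 r20 Hr2] := quotient_frechet M T0 e0.
(* Halving leaves room for the points [h *: basis_vec k + p'] within [r1] of [p], and gives
   [|q' - p'| < r2]. *)
exists (Num.min (r1 / 2) (r2 / 2)); first by rewrite lt_min !divr_gt0.
move=> t' p' q'; rewrite !lt_min => /andP[tr1 tr2] /andP[pr1 pr2] /andP[qr1 qr2].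
have half (r : R) : 0 < r -> r / 2 < r.
  by move=> r0; rewrite ltr_pdivrMr// ltr_pMr// ltr1n.
have tr1' := lt_trans tr1 (half _ r10).
rewrite mulmx_sum_row; under eq_bigr do rewrite rowK.
pose f (h : R) := X t' q' b - X t' p' b - \sum_k (q' - p') 0 k *:
  (h^-1 *: (X t' (h *: basis_vec k + p') b - X t' p' b)).
suff fl : f h @[h --> 0^'] --> X t' q' b - X t' p' b -
    \sum_k (q' - p') 0 k *: 'D_(basis_vec k) (fun p => X t' p b) p'.
  have : forall c, closed [set v : V | `|v| <= c].
    move=> c; exact: (closed_comp (fun x _ => @norm_continuous _ _ x) (@closed_le _ c)).
  move=> /(_ (e * `|q' - p'|)) cl.
  apply: (closed_cvg _ cl _ _ fl).
  near=> h; rewrite /= /f; apply: Hr2 => //.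
  - by apply: Hr1 => //; rewrite (lt_trans pr1)// half.
  - by apply: Hr1 => //; rewrite (lt_trans qr1)// half.
  - move=> k; apply: Hr1 => //; rewrite -addrA (le_lt_trans (ler_normD _ _))//.
    rewrite (splitr r1) ltrD// normrZ (@le_lt_trans _ _ (`|h| * 1))//.
      by rewrite ler_wpM2l// norm_basis_vec.
    by rewrite mulr1; near: h; apply: dnbhs0_lt; rewrite divr_gt0.
  - by near: h; exact: nbhs_dnbhs_neq.
  - rewrite -(subrKA p) (le_lt_trans (ler_normD _ _))// (splitr r2) ltrD//.
    by rewrite distrC.
  - by near: h; exact: dnbhs0_lt.
apply: cvgB; first exact: cvg_cst.
apply: cvg_big => [|k _]; first exact: add_continuous.
apply: cvgZl_tmp.
have /derivableP/is_deriveP :=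
  @position_derivable b t' p' _ (norm_basis_vec R k).
exact.
Unshelve. all: by end_near. Qed.

Lemma position_continuous (b : R) :
  continuous (fun q : V * R => X q.2 q.1 b).
Proof.
move=> [p t]; apply/cvgrPdist_le => e e0.
have [T T0 [tT bT]] := large t b.
have [M [r r0 Hr]] := traj_bounded_near hu hwp hphi p tT.
have [K K0 HK] := position_lipschitz hu hwp hphi M T0.
have eK : 0 < e / (2 * K) by rewrite divr_gt0// mulr_gt0.
have m0 : 0 < Num.min r (e / (2 * K)) by rewrite lt_min r0.
have : X t p s @[s --> t] --> X t p t by exact: position_continuous1.
rewrite (position_id hwp hphi) => /cvgrPdist_lt/(_ _ m0)/nbhs_normP[r' /= r'0 Hr'].
apply: (@nbhs_normP _ _ (p, t) _).2.
exists (Num.min r' (Num.min r (e / (2 * K)))).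
  by rewrite /= lt_min r'0.
move=> q /=; rewrite prod_normE !lt_min !gt_max/=.
move=> /and3P[/andP[_ tr'] /andP[pr tr] /andP[pe _]].
rewrite distrC in pr; rewrite distrC in tr; rewrite distrC in pe.
have := Hr' _ tr'; rewrite lt_min => /andP[Xr Xe].
(* The trajectory of [(t, p)] is restarted at time [q.2], since [position_lipschitz] compares
   trajectories with the same initial time. *)
rewrite -(position_trans hwp hphi q.2 t p b).
have tq : traj_bounded T M q.2 q.1 by exact: Hr.
have tX : traj_bounded T M q.2 (X t p q.2) by apply: Hr => //; rewrite distrC.
rewrite (le_trans (HK q.2 _ _ tq tX b bT))// mulrC -ler_pdivlMr//.
rewrite -(subrKA p) (le_trans (ler_normD _ _))//.
have -> : e / K = e / (2 * K) + e / (2 * K) by field; rewrite gt_eqF.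
by rewrite lerD// distrC ltW.
Qed.

End FlowDifferentiable.

Lemma is_derive_pair (R : realType) (U V W : normedModType R) (f : U -> V)
    (g : U -> W) x v df dg :
  is_derive x v f df -> is_derive x v g dg ->
  is_derive x v (fun y => (f y, g y)) (df, dg).
Proof. by move=> /is_deriveP ? /is_deriveP ?; apply/is_deriveP; exact: cvg_pair. Qed.

Lemma differentiable_of_bound (R : realType) (V W : normedModType R)
    (f : V -> W) x (L : {linear V -> W}) : continuous L ->
  (forall e : R, 0 < e -> exists2 r : R, 0 < r & forall y, `|y - x| < r ->
    `|f y - f x - L (y - x)| <= e * `|y - x|) ->
  differentiable f x /\ 'd f x = L :> (V -> W).
Proof.
move=> Lc fL.
have fo : f \o shift x = cst (f x) + L +o_ 0 id.
  apply/eqaddoP => e e0; have [r r0 Hr] := fL e e0.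
  apply: (@nbhs_normP _ _ (0 : V) _).2; exists r => // h /=.
  rewrite sub0r normrN => hr; have := Hr (h + x).
  by rewrite addrK !fctE /= opprD addrA; exact.
have dE := diff_unique Lc fo; split => //.
by apply/diff_locallyP; rewrite dE.
Qed.

(** * Joint C^1 regularity of the flow and invertibility of its derivative *)

Section FlowC1.
Context {R : realType} {d : nat}.
Variables (u : 'rV[R]_d -> R -> 'rV[R]_d) (phi : R -> R -> 'rV[R]_d -> 'rV[R]_d).
Hypotheses (hu : C1_velocity u) (hwp : well_posed u) (hphi : is_flow_map u phi).
Local Notation X := (position phi).
Local Notation V := 'rV[R]_d.
Local Notation J := (position_jac phi).

(** For a fixed step [h], row [k] of [h *: J] is within [e / 3 * h] of the increment [G], uniformly
    near [(p, t)], and [G] is continuous: a locally uniform limit of continuous functions. *)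
Lemma position_jac_continuous (b : R) :
  continuous (fun q : V * R => J b q.2 q.1).
Proof.
move=> [p t]; apply: (@cvg_mxP R _ (nbhs (p, t)) _ d d _ (J b t p)).2 => k j.
apply: (cvg_nbhs_normP _ (p, t) _).2 => e e0; have e30 : 0 < e / 3 by rewrite divr_gt0.
have [r r0 Hr] := position_strict_diff hu hwp hphi b t p e30.
(* With this step, base points within [h] of [p] and their shifts by [h] both stay within [r] of
   [p]. *)
pose h := r / 2; have h0 : 0 < h by rewrite divr_gt0.
pose G (q : V * R) := X q.2 (h *: basis_vec k + q.1) b - X q.2 q.1 b.
have Xc : continuous (fun q : V * R => X q.2 q.1 b).
  exact: position_continuous hu hwp hphi b.
have Gc : G q @[q --> (p, t)] --> G (p, t).
  apply: cvgB; last exact: Xc.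
  have gc : (h *: basis_vec k + q.1, q.2) @[q --> (p, t)] -->
      (h *: basis_vec k + p, t).
    apply: (cvg_nbhs_normP (fun q : V * R => (h *: basis_vec k + q.1, q.2)) (p, t) _).2.
    move=> e' e'0; exists e' => // q.
    by rewrite !prod_normE/= opprD addrACA subrr add0r => /ltW.
  exact: (cvg_comp _ (fun q : V * R => X q.2 q.1 b) gc (Xc _)).
have eh0 : 0 < e / 3 * h by rewrite mulr_gt0.
have [r' r'0 Hr'] := (cvg_nbhs_normP G (p, t) _).1 Gc _ eh0.
exists (Num.min r' h); first by rewrite lt_min r'0.
move=> [p1 t1]; rewrite lt_min => /andP[/Hr' GG]; rewrite prod_normE gt_max/=.
move=> /andP[qp qt].
have hr : h < r by rewrite ltr_pdivrMr// ltr_pMr// ltr1n.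
have hk : `|h *: basis_vec k : V| <= h.
  by rewrite normrZ gtr0_norm// ler_piMr ?norm_basis_vec// ltW.
have est (t' : R) (p' : V) : `|t' - t| < h -> `|p' - p| < h ->
    `|G (p', t') - (h *: basis_vec k) *m J b t' p'| <= e / 3 * h.
  move=> t't p'p; have := Hr t' p' (h *: basis_vec k + p').
  rewrite addrK => H; apply: le_trans (H _ _ _) _.
  - exact: lt_trans t't hr.
  - exact: lt_trans p'p hr.
  - by rewrite -addrA (le_lt_trans (ler_normD _ _))// [ltRHS]splitr ler_ltD.
  - by rewrite ler_wpM2l// ltW.
have E1 := est t p; have E2 := est t1 p1 qt qp.
rewrite !subrr !normr0 in E1; have {}E1 := E1 h0 h0.
have jacB (M N : 'M[R]_d) : M k j - N k j =
    h^-1 * ((h *: basis_vec k *m M - h *: basis_vec k *m N) 0 j).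
  by rewrite -mulmxBr -scalemxAl mxE /basis_vec -rowE !mxE mulKf// gt_eqF.
rewrite jacB.
rewrite normrM normfV (gtr0_norm h0) ler_pdivrMl//.
apply: le_trans (ler_coord_norm _ _ _) _.
have alg (x y v w : V) : x - y = (v - w) - (v - x) + (w - y).
  by apply/rowP => i; rewrite !mxE; ring.
rewrite [X in `|X|](alg _ _ (G (p1, t1)) (G (p, t))).
rewrite (le_trans (ler_normD _ _))//.
have -> : h * e = e / 3 * h + e / 3 * h + e / 3 * h by field.
apply: lerD; last exact: E1.
apply: le_trans (ler_normB _ _) _; apply: lerD; [exact: GG|exact: E2].
Qed.

Lemma position_strict_diff_at (b t : R) (p : V) (e : R) : 0 < e ->
  exists2 r : R, 0 < r & forall (t' : R) (p' q' : V),
    `|t' - t| < r -> `|p' - p| < r -> `|q' - p| < r ->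
    `|X t' q' b - X t' p' b - (q' - p') *m J b t p| <= e * `|q' - p'|.
Proof.
move=> e0; have e20 : 0 < e / 2 by rewrite divr_gt0.
have [r r0 Hr] := position_strict_diff hu hwp hphi b t p e20.
have ed0 : 0 < e / 2 / d.+1%:R by rewrite divr_gt0.
have [r' r'0 Hr'] := (cvg_nbhs_normP (fun q : V * R => J b q.2 q.1)
  (p, t) (J b t p)).1 (@position_jac_continuous b (p, t)) _ ed0.
exists (Num.min r r'); first by rewrite lt_min r0.
move=> t' p' q'; rewrite !lt_min => /andP[tr tr'] /andP[pr pr'] /andP[qr qr'].
rewrite -(subrKA ((q' - p') *m J b t' p')) (le_trans (ler_normD _ _))//.
rewrite (splitr e) mulrDl lerD ?Hr// -mulmxBr.
rewrite (le_trans (ler_norm_mulmx _ _))// mulrAC ler_wpM2r//.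
have := Hr' (p', t'); rewrite /= prod_normE gt_max /=.
rewrite pr' tr' => /(_ isT) H.
rewrite (le_trans (ler_wpM2l _ H))// mulrCA ger_pMr// ler_pdivrMr//.
by rewrite mul1r ler_nat.
Qed.

Lemma position_diff (b : R) (p : V) (t : R) :
  differentiable (fun q : V * R => X q.2 q.1 b) (p, t) /\
  forall w (s : R), 'd (fun q : V * R => X q.2 q.1 b) (p, t) (w, s) =
    (w - s *: u p t) *m J b t p.
Proof.
pose L0 (q : V * R) := (q.1 - q.2 *: u p t) *m J b t p.
have L0lin : linear L0.
  move=> c x y; rewrite /L0 /= scalemxAl -mulmxDl; congr (_ *m _).
  by rewrite scalerDl scalerBr scalerA opprD addrACA.
pose L : {linear (V * R)%type -> V} :=
  HB.pack L0 (GRing.isLinear.Build _ _ _ _ _ L0lin).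
have Lc : continuous L.
  move=> q; apply: cvg_mulmx; last exact: cvg_cst.
  by apply: cvgB; [exact: cvg_fst|apply: cvgZr_tmp; exact: cvg_snd].
suff [? dE] : differentiable (fun q : V * R => X q.2 q.1 b) (p, t) /\
    'd (fun q : V * R => X q.2 q.1 b) (p, t) = L :> ((V * R)%type -> V).
  by split=> // w s; rewrite dE.
apply: differentiable_of_bound => // e e0.
(* [1 + |u p t|] bounds the displacement of [X t p t'] from [p] per unit of time, and one more unit
   accounts for [p' - p]. *)
pose C : R := 2 + `|u p t|.
have C0 : 0 < C by rewrite ltr_wpDr.
have e10 : 0 < e / 2 / C by rewrite !divr_gt0.
have [r r0 Hr] := position_strict_diff_at b t p e10.
(* The bound [1] serves the crude displacement estimate, the other one absorbs the factor
   [d * |J b t p|] of the linear term. *)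
pose e2 := Num.min 1 (e / 2 / (d.+1%:R * (`|J b t p| + 1))).
have e20 : 0 < e2 by rewrite lt_min ltr01 !divr_gt0// mulr_gt0// ltr_wpDl.
(* [X t p b = X t' (X t p t') b], so that only positions at the same time [t']
   have to be compared. *)
have [r3 r30 Hr3] := is_derive_bound (position_derive hwp hphi t p t) e20.
rewrite (position_id hwp hphi) in Hr3.
exists (Num.min (Num.min r r3) (r / C)); first by rewrite !lt_min r0 r30 divr_gt0.
move=> [p' t']; rewrite prod_normE /= !lt_min !gt_max.
move=> /andP[/andP[/andP[pr tr] /andP[_ tr3]] /andP[_ trC]].
set D := Num.max _ _; have pD : `|p' - p| <= D by rewrite le_max lexx.
have tD : `|t' - t| <= D by rewrite le_max lexx orbT.
have D0 : 0 <= D by rewrite (le_trans _ pD).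
have {}Hr3 := Hr3 _ tr3.
have xp : `|X t p t' - p| <= (1 + `|u p t|) * `|t' - t|.
  rewrite -(subrK ((t' - t) *: u p t) (X t p t' - p)) (le_trans (ler_normD _ _))//.
  rewrite mulrDl lerD//; last by rewrite normrZ mulrC.
  by rewrite (le_trans Hr3)// ler_wpM2r// ge_min lexx.
have xr : `|X t p t' - p| < r.
  rewrite (le_lt_trans xp)// (@le_lt_trans _ _ (C * `|t' - t|))//.
    by rewrite ler_wpM2r// lerD2r ler1n.
  by rewrite mulrC -ltr_pdivlMr.
have px : `|p' - X t p t'| <= C * D.
  rewrite -(subrKA p) (le_trans (ler_normD _ _))// [`|p - _|]distrC.
  rewrite (_ : C = 1 + (1 + `|u p t|)); last by rewrite addrA.
  rewrite mulrDl mul1r lerD// (le_trans xp)// ler_wpM2l//.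
have H := Hr t' (X t p t') p' tr xr pr.
rewrite (position_trans hwp hphi) in H.
rewrite -(subrKA ((p' - X t p t') *m J b t p)) (le_trans (ler_normD _ _))//.
rewrite (splitr e) mulrDl lerD//.
  by rewrite (le_trans H)// (le_trans (ler_wpM2l (ltW e10) px))// mulrA divfK// gt_eqF.
rewrite /L/= /L0/= -mulmxBl (le_trans (ler_norm_mulmx _ _))//.
have -> : p' - X t p t' - (p' - p - (t' - t) *: u p t) =
    - (X t p t' - p - (t' - t) *: u p t).
  by apply/rowP => j; rewrite !mxE; ring.
rewrite normrN mulrAC.
have dJ0 : 0 <= d%:R * `|J b t p| by rewrite mulr_ge0.
rewrite (le_trans (ler_wpM2l dJ0 Hr3))//.
have e2D : e2 * `|t' - t| <= e / 2 / (d.+1%:R * (`|J b t p| + 1)) * D.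
  by rewrite ler_pM ?(ltW e20)// ge_min lexx orbT.
rewrite (le_trans (ler_wpM2l dJ0 e2D))// mulrA ler_wpM2r// mulrCA ger_pMr ?divr_gt0//.
rewrite ler_pdivrMr ?mulr_gt0 ?ltr_wpDl// mul1r ler_pM//.
  by rewrite ler_nat.
by rewrite lerDl.
Qed.

Lemma position_curve_derive (b : R) (x : R -> V) (tau : R -> R) (s : R) dx dtau :
  is_derive s 1 x dx -> is_derive s 1 tau dtau ->
  is_derive s 1 (fun h => X (tau h) (x h) b)
    ((dx - dtau *: u (x s) (tau s)) *m J b (tau s) (x s)).
Proof.
move=> dxP dtauP; have [dX <-] := position_diff b (x s) (tau s).
exact: (is_derive_curve dX (is_derive_pair dxP dtauP)).
Qed.

(** Flowing from [t] to [b] and back is the identity, so by the chain rule the two derivatives are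
    inverse to each other. *)
Lemma position_jac_unit (b t : R) (p : V) : J b t p \in unitmx.
Proof.
suff : J b t p *m J t b (X t p b) = 1%:M.
  by move=> /mulmx1_unit[uJ _]; exact: uJ.
apply/row_matrixP => k; rewrite !rowE mulmxA mulmx1.
have := position_curve_derive b (is_derive_line p (basis_vec k) 0)
  (is_derive_cst t (0 : R) 1).
move=> /(position_curve_derive t)/(_ (is_derive_cst b (0 : R) 1)).
rewrite !scale0r !addr0 !subr0 /=.
under eq_fun do rewrite (position_trans hwp hphi) (position_id hwp hphi).
move=> [_ E1]; have [_ E2] := is_derive_line p (basis_vec k) 0.
by rewrite -E1; exact: E2.
Qed.

End FlowC1.

(** * Normals to the faces *)

Lemma dotpE (R : realType) m (v w : 'rV[R]_m) : dotp v w = \sum_j v 0 j * w 0 j.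
Proof. by rewrite /dotp mxE; apply: eq_bigr => j _; rewrite mxE. Qed.

Lemma dotpC (R : realType) m (v w : 'rV[R]_m) : dotp v w = dotp w v.
Proof. by rewrite !dotpE; apply: eq_bigr => j _; rewrite mulrC. Qed.

Lemma dotpZl (R : realType) m c (v w : 'rV[R]_m) : dotp (c *: v) w = c * dotp v w.
Proof. by rewrite /dotp -scalemxAl mxE. Qed.

Lemma dotpBl (R : realType) m (v v' w : 'rV[R]_m) :
  dotp (v - v') w = dotp v w - dotp v' w.
Proof. by rewrite /dotp mulmxBl !mxE. Qed.

Lemma dotp_ge0 (R : realType) m (v : 'rV[R]_m) : 0 <= dotp v v.
Proof. by rewrite dotpE sumr_ge0// => j _; rewrite -expr2 sqr_ge0. Qed.

Lemma dotp_eq0 (R : realType) m (v : 'rV[R]_m) : (dotp v v == 0) = (v == 0).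
Proof.
apply/eqP/eqP => [|->]; last by rewrite /dotp mul0mx mxE.
rewrite dotpE => /eqP; rewrite psumr_eq0; last by move=> j _; rewrite -expr2 sqr_ge0.
move=> /allP v0; apply/rowP => j; rewrite mxE; apply/eqP.
by have := v0 j (mem_index_enum _); rewrite -expr2 sqrf_eq0.
Qed.

Section FaceNormal.
Context {R : realType} {m : nat}.
Variables (w : 'I_m.+1 -> 'rV[R]_m.+1) (i : 'I_m.+1).
Implicit Types (v : 'rV[R]_m.+1) (s : bool).

Let frame v : 'M[R]_m.+1 := \matrix_k (if k == i then v else w k).
Let tangents : 'M[R]_(m, m.+1) := row' i (\matrix_k w k).

Definition face_wedge v : R := wedge (fun k => if k == i then v else w k).

(** [cycle_normal] for an arbitrary family of vectors; with [w := pderiv psi ^~ z] the two are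
    convertible. *)
Definition face_normal s v : Prop :=
  [/\ dotp v v = 1, forall k, k != i -> dotp v (w k) = 0,
      if s then 0 <= face_wedge v else face_wedge v <= 0
    & face_wedge v = 0 -> ~~ row_free tangents].

(** Cofactors of column [i], which do not involve [w i]: the generalized cross product of the
    remaining vectors, signed for an argument in slot [i]. *)
Definition face_cross : 'rV[R]_m.+1 :=
  \row_j cofactor (\matrix_(a, b) w b 0 a) j i.

Let face_wedge_frame v : face_wedge v = \det (frame v).
Proof.
rewrite /face_wedge /wedge -det_tr; congr (\det _).
by apply/matrixP => a b; rewrite !mxE.
Qed.

Let row'_frame v : row' i (frame v) = tangents.
Proof. by apply/matrixP => a b; rewrite !mxE [lift _ _ == _]eq_sym (negbTE (neq_lift _ _)). Qed.

Lemma face_wedge_cross v : face_wedge v = dotp v face_cross.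
Proof.
rewrite /face_wedge /wedge (expand_det_col _ i) dotpE; apply: eq_bigr => j _.
rewrite !mxE eqxx; congr (_ * (_ * \det _)).
by apply/matrixP => a b; rewrite !mxE [lift _ _ == _]eq_sym (negbTE (neq_lift _ _)).
Qed.

Lemma face_wedgeZ c v : face_wedge (c *: v) = c * face_wedge v.
Proof. by rewrite !face_wedge_cross dotpZl. Qed.

(** Pairing with [w k] puts [w k] in slot [i] as well, and a determinant with a repeated vector
    vanishes. *)
Lemma face_cross_orth k : k != i -> dotp face_cross (w k) = 0.
Proof.
move=> ki; rewrite dotpC -face_wedge_cross face_wedge_frame.
apply: (determinant_alternate ki) => j; rewrite !mxE eqxx.
by rewrite (negbTE ki).
Qed.

Lemma row_free_face v : face_wedge v != 0 -> row_free tangents.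
Proof.
rewrite face_wedge_frame => d0.
have uM : frame v \in unitmx by rewrite unitmxE unitfE.
apply: inj_row_free => y y0.
(* [c] is [y] with a zero coefficient inserted at position [i]. *)
pose c := y *m row' i 1%:M.
have c0 : c = 0.
  have rM (N : 'M[R]_m.+1) : row' i N = row' i 1%:M *m N.
    by apply/row_matrixP => k; rewrite row_mul !row_rowsub -?row_mul ?mul1mx.
  apply: (row_free_inj (_ : row_free (frame v))); first by rewrite row_free_unit.
  by rewrite mul0mx /c -mulmxA -rM row'_frame.
apply/rowP => k; have /rowP/(_ (lift i k)) := c0.
rewrite !mxE => <-; rewrite (bigD1 k)//= !mxE eqxx mulr1 big1 ?addr0// => l lk.
by rewrite !mxE (inj_eq lift_inj) (negbTE lk) mulr0.
Qed.

(** Pairing a vanishing combination of the rows with [v] isolates the coefficient of [v]; the others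
    vanish by independence of the tangents. *)
Lemma frame_unit v : row_free tangents -> dotp v v = 1 ->
  (forall k, k != i -> dotp v (w k) = 0) -> frame v \in unitmx.
Proof.
move=> fT v1 vo; rewrite -row_free_unit; apply: inj_row_free => c c0.
have frv : frame v *m v^T = \col_k (k == i)%:R.
  apply/colP => k; rewrite [RHS]mxE -[LHS]/((frame v *m v^T) k 0).
  have -> : (frame v *m v^T) k 0 = dotp (row k (frame v)) v.
    by rewrite /dotp -row_mul [RHS]mxE.
  rewrite rowK; case: eqP => [_|/eqP ki] //; by rewrite dotpC vo.
have ci : c 0 i = 0.
  have : (c *m (frame v *m v^T)) 0 0 = 0 by rewrite mulmxA c0 mul0mx mxE.
  rewrite frv mxE (bigD1 i)//= !mxE eqxx mulr1 big1 ?addr0// => k ki.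
  by rewrite !mxE (negbTE ki) mulr0.
have cT : col' i c *m tangents = 0.
  rewrite -(row'_frame v) -[RHS]c0; apply/rowP => j.
  rewrite !mxE (bigD1_ord i)//= ci mul0r add0r.
  by apply: eq_bigr => k _; rewrite !mxE.
have := row_free_inj fT (etrans cT (esym (mul0mx _ _))) => c'0.
apply/rowP => j; rewrite mxE; case: (unliftP i j) => [k ->|->//].
by have /rowP/(_ k) := c'0; rewrite !mxE.
Qed.

Lemma face_wedge_neq0 v : row_free tangents -> dotp v v = 1 ->
  (forall k, k != i -> dotp v (w k) = 0) -> face_wedge v != 0.
Proof.
by move=> fT v1 /(frame_unit fT v1); rewrite unitmxE unitfE face_wedge_frame.
Qed.

(** Singular points are included: whatever their rank, [m] vectors leave an orthogonal direction in
    dimension [m.+1], and one of its two unit vectors has the right sign. *)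
Lemma face_normal_exists s : exists v, face_normal s v.
Proof.
have [v v1 vo] : exists2 v, dotp v v = 1 & forall k, k != i -> dotp v (w k) = 0.
  have /rowV0Pn[x xK x0] : kermx tangents^T != 0.
    rewrite -mxrank_eq0 mxrank_ker mxrank_tr -lt0n subn_gt0.
    by rewrite ltnS rank_leq_row.
  have xx0 : 0 < dotp x x by rewrite lt0r dotp_eq0 x0 dotp_ge0.
  exists ((Num.sqrt (dotp x x))^-1 *: x).
    rewrite dotpZl dotpC dotpZl mulrA -expr2 exprVn sqr_sqrtr ?dotp_ge0//.
    by rewrite mulVf// gt_eqF.
  move=> k ki; rewrite dotpZl; case: (unliftP i k) ki => [l ->|->]; last by rewrite eqxx.
  move=> _; have /sub_kermxP/rowP/(_ l) := xK; rewrite mxE => xl.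
  have -> : dotp x (w (lift i l)) = 0; last by rewrite mulr0.
  rewrite mxE in xl; rewrite dotpE -[RHS]xl.
  by apply: eq_bigr => j _; rewrite !mxE.
have n0 v' : dotp v' v' = 1 -> (forall k, k != i -> dotp v' (w k) = 0) ->
    face_wedge v' = 0 -> ~~ row_free tangents.
  by move=> v'1 v'o v'0; apply/negP => /face_wedge_neq0/(_ v'1 v'o); rewrite v'0 eqxx.
have [sv|sv] := boolP (if s then 0 <= face_wedge v else face_wedge v <= 0).
  by exists v; split => //; exact: n0.
have Nv1 : dotp (- v) (- v) = 1 by rewrite -scaleN1r dotpZl dotpC dotpZl v1; ring.
have Nvo k : k != i -> dotp (- v) (w k) = 0.
  by move=> ki; rewrite -scaleN1r dotpZl vo// mulr0.
exists (- v); split => //; last exact: n0.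
rewrite -scaleN1r face_wedgeZ mulN1r.
by case: s sv; rewrite -ltNge => /ltW; rewrite ?oppr_ge0 ?oppr_le0.
Qed.

(** [v' - dotp v' v *: v] is orthogonal to a basis, so [v'] is [v] or [- v]; the sign rule excludes
    [- v] because the wedge is nonzero. *)
Lemma face_normal_unique s v v' : row_free tangents ->
  face_normal s v -> face_normal s v' -> v' = v.
Proof.
move=> fT [v1 vo vs v0] [v'1 v'o v's v'0].
have vN0 := face_wedge_neq0 fT v1 vo.
have v'E : v' = dotp v' v *: v.
  apply/eqP; rewrite -subr_eq0; apply/eqP; set x := _ - _.
  have xv : dotp x v = 0 by rewrite dotpBl dotpZl v1 mulr1 subrr.
  have xo k : k != i -> dotp x (w k) = 0.
    by move=> ki; rewrite dotpBl dotpZl vo// v'o// mulr0 subrr.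
  have : x *m (frame v)^T = 0.
    apply/rowP => k; rewrite mxE.
    have -> : (0 : 'rV[R]_m.+1) 0 k = 0 by rewrite mxE.
    transitivity (dotp x (if k == i then v else w k)).
      by rewrite dotpE; apply: eq_bigr => j _; rewrite !mxE.
    by case: eqP => [//|/eqP /xo].
  have uT : (frame v)^T \in unitmx by rewrite unitmx_tr frame_unit.
  by move=> /(congr1 (mulmx^~ (invmx (frame v)^T))); rewrite mulmxK// mul0mx.
move: v'E; set c := dotp v' v => v'E; have c2 : c ^+ 2 = 1.
  by have := v'1; rewrite v'E dotpZl dotpC dotpZl v1 mulr1 -expr2.
have := v's; rewrite v'E face_wedgeZ => v's'.
move/eqP: c2; rewrite sqrf_eq1 => /orP[/eqP ->|/eqP cN]; first by rewrite scale1r.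
move: v's'; rewrite cN mulN1r => v's'; exfalso.
move/negP: vN0; apply; rewrite eq_le.
by move: v's' vs; case: (s); rewrite ?oppr_ge0 ?oppr_le0 => -> ->.
Qed.

Lemma face_cross_neq0 : row_free tangents -> 0 < dotp face_cross face_cross.
Proof.
move=> fT; have [v [v1 vo _ _]] := face_normal_exists true.
have := face_wedge_neq0 fT v1 vo; rewrite face_wedge_cross lt0r dotp_ge0 andbT.
by apply: contraNN; rewrite dotp_eq0 => /eqP ->; rewrite dotpC /dotp mul0mx mxE.
Qed.

(** An explicit normal, continuous in the tangents, to which uniqueness will equate any chosen
    normal. *)
Lemma face_normal_cross s : row_free tangents -> face_normal s
  (((-1) ^+ (~~ s) / Num.sqrt (dotp face_cross face_cross)) *: face_cross).
Proof.
move=> fT; have c0 := face_cross_neq0 fT.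
set D := dotp _ _ in c0 *; have sD : 0 < Num.sqrt D by rewrite sqrtr_gt0.
set a := _ / _; have a2 : a ^+ 2 * D = 1.
  by rewrite expr_div_n sqrr_sign sqr_sqrtr ?(ltW c0)// mul1r mulVf// gt_eqF.
have wE : face_wedge (a *: face_cross) = a * D by rewrite face_wedge_cross dotpZl.
split.
- by rewrite dotpZl dotpC dotpZl mulrA -expr2.
- by move=> k ki; rewrite dotpZl face_cross_orth// mulr0.
- rewrite wE /a; case: (s); rewrite /= ?expr0 ?expr1 ?mulN1r ?mul1r ?mulNr ?oppr_le0.
    by rewrite mulr_ge0 ?invr_ge0 ?(ltW sD) ?(ltW c0).
  by rewrite mulr_ge0 ?invr_ge0 ?(ltW sD) ?(ltW c0).
- move=> /eqP; rewrite wE mulf_eq0 (gt_eqF c0) orbF => /eqP a0.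
  by move: a2; rewrite a0 expr0n mul0r => /eqP; rewrite eq_sym oner_eq0.
Qed.

End FaceNormal.

(** * Continuity of the normal and existence of orientations *)

Lemma cvg_det (R : realType) (T : Type) (F : set_system T) {FF : Filter F} n
    (M : T -> 'M[R]_n) (A : 'M[R]_n) :
  M x @[x --> F] --> A -> \det (M x) @[x --> F] --> \det A.
Proof.
move=> /cvg_mxP MA; rewrite /determinant.
apply: cvg_big => [|s _]; first exact: add_continuous.
apply: cvgM; first exact: cvg_cst.
by apply: cvg_big => [|k _]; [exact: mul_continuous|exact: MA].
Qed.

Lemma cvg_dotp (R : realType) (T : Type) (F : set_system T) {FF : Filter F} n
    (f g : T -> 'rV[R]_n) (v w : 'rV[R]_n) :
  f x @[x --> F] --> v -> g x @[x --> F] --> w ->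
  dotp (f x) (g x) @[x --> F] --> dotp v w.
Proof.
move=> /cvg_mxP fv /cvg_mxP gw; rewrite dotpE; under eq_fun do rewrite dotpE.
apply: cvg_big => [|k _]; first exact: add_continuous.
by apply: cvgM; [exact: fv|exact: gw].
Qed.

Lemma cvg_face_cross (R : realType) (T : Type) (F : set_system T) {FF : Filter F}
    m (w : T -> 'I_m.+1 -> 'rV[R]_m.+1) (l : 'I_m.+1 -> 'rV[R]_m.+1) i :
  (forall k, k != i -> w x k @[x --> F] --> l k) ->
  face_cross (w x) i @[x --> F] --> face_cross l i.
Proof.
move=> wl; apply/cvg_mxP => a b; rewrite mxE; under eq_fun do rewrite mxE.
apply: cvgM; first exact: cvg_cst.
apply: cvg_det; apply/cvg_mxP => c d; rewrite !mxE; under eq_fun do rewrite !mxE.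
have wd : w x (lift i d) @[x --> F] --> l (lift i d).
  by apply: wl; rewrite eq_sym neq_lift.
exact: (cvg_mxP _ _).1 wd 0 (lift b c).
Qed.

(** Allows one normal to be chosen per point rather than per face. *)
Lemma face_unique (R : realType) m (i j : 'I_m.+1) (s s' : bool) (z : 'rV[R]_m.+1) :
  face i s z -> face j s' z -> i = j /\ s = s'.
Proof.
have bool01 (b : bool) : ~~ (0 < (b%:R : R) < 1).
  by case: b; rewrite ltxx ?andbF.
move=> [zi zj] [z'j z'i]; have ij : i = j.
  by apply/eqP/negPn/negP => /z'i; rewrite zi; exact/negP.
split=> //; apply/eqP; move: z'j; rewrite -ij zi => /eqP.
by rewrite eqr_nat; case: (s); case: (s').
Qed.

(** Regularity is an open condition, the nonvanishing of the cross product; so near the limit [N]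
    coincides with the explicit normal. *)
Lemma face_normal_continuous (R : realType) m (T : Type) (F : set_system T)
    {FF : Filter F} (w : T -> 'I_m.+1 -> 'rV[R]_m.+1) (l : 'I_m.+1 -> 'rV[R]_m.+1)
    i s (N : T -> 'rV[R]_m.+1) (v : 'rV[R]_m.+1) :
  row_free (row' i (\matrix_k l k)) ->
  (forall k, k != i -> w x k @[x --> F] --> l k) ->
  (\forall x \near F, face_normal (w x) i s (N x)) -> face_normal l i s v ->
  N x @[x --> F] --> v.
Proof.
move=> fT wl Nw lv; have c0 := face_cross_neq0 fT.
have wc : face_cross (w x) i @[x --> F] --> face_cross l i by exact: cvg_face_cross.
have dc : dotp (face_cross (w x) i) (face_cross (w x) i) @[x --> F] -->
    dotp (face_cross l i) (face_cross l i) by exact: cvg_dotp.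
rewrite -(face_normal_unique fT lv (face_normal_cross s fT)).
have cvgf : ((-1) ^+ (~~ s) / Num.sqrt (dotp (face_cross (w x) i) (face_cross (w x) i)))
    *: face_cross (w x) i @[x --> F] -->
    ((-1) ^+ (~~ s) / Num.sqrt (dotp (face_cross l i) (face_cross l i)))
    *: face_cross l i.
  apply: cvgZ => //; apply: cvgM; first exact: cvg_cst.
  apply: cvgV; first by rewrite gt_eqF// sqrtr_gt0.
  exact: (cvg_comp _ _ dc (@sqrt_continuous R _)).
apply: cvg_trans cvgf; apply: near_eq_cvg.
near=> x.
have xN : face_normal (w x) i s (N x) by near: x.
have xc : 0 < dotp (face_cross (w x) i) (face_cross (w x) i).
  by near: x; exact: (cvgr_gt _ dc).
have fx : row_free (row' i (\matrix_k w x k)).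
  by apply: (row_free_face (v := face_cross (w x) i)); rewrite face_wedge_cross gt_eqF.
exact/esym/(face_normal_unique fx (face_normal_cross s fx) xN).
Unshelve. all: by end_near. Qed.

Lemma cycle_orientation_exists (R : realType) m
    (psi : 'rV[R]_m.+1 -> 'rV[R]_m.+1) :
  (forall i s z, face i s z -> forall k, k != i ->
    derivable psi z (basis_vec k) /\
    pderiv psi k x @[x --> within (face i s) (nbhs z)] --> pderiv psi k z) ->
  exists N, cycle_orientation psi N.
Proof.
move=> psiP.
have /choice[N NP] : forall z, exists v, forall i s, face i s z ->
    face_normal (pderiv psi ^~ z) i s v.
  move=> z; have [[i [s zis]]|nf] := pselect (exists i s, face i s z).
    have [v vP] := face_normal_exists (pderiv psi ^~ z) i s.
    by exists v => j s' /(face_unique zis)[<- <-].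
  (* Nothing is required off the open faces, so [0] is a default value. *)
  by exists 0 => i s zis; exfalso; apply: nf; exists i, s.
exists N => i s z zis; split.
- by move=> k ki; have [] := psiP i s z zis k ki.
- exact: NP.
- move=> reg; apply: (face_normal_continuous (w := fun x k => pderiv psi k x) reg)
    (NP z i s zis).
    by move=> k ki; have [_] := psiP i s z zis k ki.
  by rewrite near_withinE; near=> x; exact: NP.
Unshelve. all: by end_near. Qed.

(** * Topology of the cube *)

Definition closed_cube (R : realType) m : set 'rV[R]_m :=
  [set z | forall i, 0 <= z 0 i <= 1].
Arguments closed_cube {R} m.

Lemma interior_cube (R : realType) m : interior (cube m) = cube m :> set 'rV[R]_m.
Proof.
apply/seteqP; split; first exact: interior_subset.
move=> z zc; suff : \forall y \near z, forall i : 'I_m, 0 < (y : 'rV[R]_m) 0 i < 1 by [].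
near=> y; near: y; apply: filter_forall => i.
have /andP[zi0 zi1] := zc i.
have zi : (y : 'rV[R]_m) 0 i @[y --> z] --> z 0 i by exact: coord_continuous.
near=> y; apply/andP; split; near: y.
  exact: (cvgr_gt _ zi).
exact: (cvgr_lt _ zi).
Unshelve. all: by end_near. Qed.

Lemma closed_closed_cube (R : realType) m : closed (closed_cube m : set 'rV[R]_m).
Proof.
have -> : closed_cube m = \bigcap_i [set z : 'rV[R]_m | 0 <= z 0 i <= 1].
  by apply/seteqP; split=> z zc i; [move=> _|]; exact: zc.
apply: closed_bigI => i _.
have -> : [set z : 'rV[R]_m | 0 <= z 0 i <= 1] =
    (fun z : 'rV[R]_m => z 0 i) @^-1` `[0, 1]%classic.
  by apply/seteqP; split=> z; rewrite /= in_itv.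
apply: closed_comp => [z _|]; [exact: coord_continuous|exact: itv_closed].
Qed.

(** Points of a closed cube or face are approached along the segment to its centre [c]. *)
Lemma closure_segment (R : realType) (V : normedModType R) (A : set V) (z c : V) :
  `|c - z| <= 1 -> (forall h : R, 0 < h < 1 -> A (z + h *: (c - z))) ->
  closure A z.
Proof.
move=> cz zA B /nbhs_normP[r /= r0 rB].
pose h := Num.min 2^-1 (r / 2).
have h0 : 0 < h by rewrite lt_min invr_gt0 divr_gt0// andbT.
have h1 : h < 1 by rewrite gt_min invf_lt1// ltr1n.
exists (z + h *: (c - z)); split; first by apply: zA; rewrite h0.
apply: rB; rewrite /= opprD addrA subrr sub0r normrN normrZ gtr0_norm//.
rewrite (le_lt_trans (ler_piMr (ltW h0) cz))// gt_min; apply/orP; right.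
by rewrite ltr_pdivrMr// ltr_pMr// ltr1n.
Qed.

Lemma center_norm (R : realType) m (z c : 'rV[R]_m) : closed_cube m z ->
  closed_cube m c -> `|c - z| <= 1.
Proof.
move=> zc cc; apply: mx_norm_le => // i j; rewrite ord1 !mxE.
have /andP[z0 z1] := zc j; have /andP[c0 c1] := cc j.
by rewrite ler_norml; lra.
Qed.

Lemma closure_cube (R : realType) m : closure (cube m) = closed_cube m :> set 'rV[R]_m.
Proof.
apply/seteqP; split.
  rewrite [X in _ `<=` X](closure_id _).1; last exact: closed_closed_cube.
  by apply: closure_subset => z zc i; have /andP[? ?] := zc i; rewrite !ltW.
move=> z zc; apply: (@closure_segment _ _ _ z (const_mx 2^-1)).
  by apply: center_norm => // i; rewrite mxE; lra.
move=> h /andP[h0 h1] i; rewrite !mxE; have /andP[z0 z1] := zc i.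
by apply/andP; split; nra.
Qed.

Lemma closure_face (R : realType) m (i : 'I_m.+1) (s : bool) :
  closure (face i s) = [set z : 'rV[R]_m.+1 | z 0 i = s%:R /\ closed_cube m.+1 z].
Proof.
have s01 : 0 <= (s%:R : R) <= 1 by rewrite ler0n lern1 leq_b1.
apply/seteqP; split.
  have cl : closed [set z : 'rV[R]_m.+1 | z 0 i = s%:R /\ closed_cube m.+1 z].
    apply: closedI; last exact: closed_closed_cube.
    apply: (@closed_comp _ _ (fun z : 'rV[R]_m.+1 => z 0 i) [set s%:R]) => [z _|].
      exact: coord_continuous.
    exact: closed_eq.
  rewrite [X in _ `<=` X](closure_id _).1//.
  apply: closure_subset => z [zi zj]; split => // j.
  by have [->|/zj/andP[? ?]] := eqVneq j i; rewrite ?zi// !ltW.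
move=> z [zi zc].
apply: (@closure_segment _ _ _ z (\row_j if j == i then s%:R else 2^-1)).
  by apply: center_norm => // j; rewrite mxE; case: eqP => // _; lra.
move=> h /andP[h0 h1]; split; first by rewrite !mxE eqxx zi; ring.
move=> j ji; rewrite !mxE (negbTE ji); have /andP[z0 z1] := zc j.
by apply/andP; split; nra.
Qed.

Lemma face_closed_cube (R : realType) m (i : 'I_m.+1) (s : bool) (z : 'rV[R]_m.+1) :
  face i s z -> closed_cube m.+1 z.
Proof. by move=> /subset_closure; rewrite closure_face => -[]. Qed.

Lemma frontier_cubeP (R : realType) m (z : 'rV[R]_m) :
  frontier (cube m) z <-> closed_cube m z /\ exists i (s : bool), z 0 i = s%:R.
Proof.
rewrite /frontier closure_cube interior_cube; split.
  move=> [zc znc]; split => //; apply: contrapT => H; apply: znc => i.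
  have /andP[z0 z1] := zc i; rewrite !lt_neqAle z0 z1 !andbT.
  apply/andP; split; apply/eqP => zi; apply: H; exists i.
    by exists false; rewrite -zi.
  by exists true.
move=> [zc [i [s zi]]]; split => // /(_ i); rewrite zi.
by case: (s); rewrite ltxx ?andbF.
Qed.

Lemma face_line (R : realType) m (i : 'I_m.+1) s (z : 'rV[R]_m.+1) k :
  face i s z -> k != i -> exists2 r : R, 0 < r &
    forall h : R, `|h| < r -> face i s (z + h *: basis_vec k).
Proof.
move=> [zi zj] ki; have /andP[zk0 zk1] := zj k ki.
exists (Num.min (z 0 k) (1 - z 0 k)); first by rewrite lt_min zk0 subr_gt0.
move=> h; rewrite lt_min !ltr_norml => /andP[/andP[h1 h2] /andP[h3 h4]].
have bE (j : 'I_m.+1) : (z + h *: basis_vec k) 0 j = z 0 j + h * (j == k)%:R.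
  by rewrite !mxE eqxx.
split; first by rewrite bE eq_sym (negbTE ki) mulr0 addr0.
move=> j ji; rewrite bE; have [->|_] := eqVneq j k; last by rewrite mulr0 addr0 zj.
by rewrite mulr1; apply/andP; split; lra.
Qed.

(** * The map chi *)

Lemma is_derive_lineP (R : realType) (V W : normedModType R) (f : V -> W) x v l :
  is_derive x v f l <-> is_derive (0 : R) 1 (fun h : R => f (x + h *: v)) l.
Proof.
suff e : (fun h : R => h^-1 *: (f (h *: v + x) - f x)) =
    (fun h : R => h^-1 *: (f (x + ((h *: 1 + 0) : R) *: v) - f (x + (0 : R) *: v))).
  by split=> /is_deriveP H; apply/is_deriveP; [rewrite -e|rewrite e].
by apply/funext => h; rewrite addr0 [_%:A]mulr1 scale0r addr0 [h *: v + x]addrC.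
Qed.

(* The condition on the derivative in [C1_on]. *)
Definition rel_derivative (R : realType) (V W : normedModType R) (A : set V)
    (f : V -> W) (x : V) (L : V -> W) : Prop :=
  forall e : R, 0 < e ->
    \forall y \near within A (nbhs x), `|f y - f x - L (y - x)| <= e * `|y - x|.

Lemma rel_derivativeP (R : realType) (V W : normedModType R) (A : set V)
    (f : V -> W) (x : V) (L : V -> W) :
  rel_derivative A f x L <-> forall e : R, 0 < e -> exists2 r : R, 0 < r &
    forall y, A y -> `|y - x| < r -> `|f y - f x - L (y - x)| <= e * `|y - x|.
Proof.
split=> H e /H{H}; last first.
  move=> [r r0 Hr]; rewrite near_withinE; apply/nbhs_normP; exists r => // y /=.
  by rewrite distrC => yr Ay; exact: Hr.
rewrite near_withinE => /nbhs_normP[r /= r0 Hr]; exists r => // y Ay yr.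
by apply: Hr => //=; rewrite distrC.
Qed.

(** A relative derivative gives an ordinary two-sided one in any direction along which [A] contains
    a segment around [x], even if [x] is a boundary point of [A]. *)
Lemma rel_derivative_line (R : realType) (V W : normedModType R) (A : set V)
    (f : V -> W) (x w : V) (L : {linear V -> W}) :
  rel_derivative A f x L ->
  (exists2 r : R, 0 < r & forall h : R, `|h| < r -> A (x + h *: w)) ->
  is_derive (0 : R) 1 (fun h : R => f (x + h *: w)) (L w).
Proof.
move=> /rel_derivativeP fL [r r0 Hr]; apply: (is_derive_lineP _ _ _ _).1.
apply/is_deriveP; have w1 : 0 < `|w| + 1 by rewrite ltr_wpDl.
apply/cvgrPdist_le => e e0.
have [r' r'0 Hr'] := fL _ (divr_gt0 e0 w1).
rewrite near_withinE; apply/nbhs_normP.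
exists (Num.min r (r' / (`|w| + 1))); first by rewrite /= lt_min r0 divr_gt0.
move=> h; rewrite /= sub0r normrN lt_min => /andP[hr hr'] h0.
have := Hr' (x + h *: w) (Hr h hr).
rewrite [x + _]addrC addrK linearZ_LR /= => H.
have -> : L w - h^-1 *: (f (h *: w + x) - f x) =
    - (h^-1 *: (f (h *: w + x) - f x - h *: L w)).
  by rewrite [in RHS]scalerBr scalerA mulVf// scale1r opprB.
rewrite normrN normrZ normfV ler_pdivrMl ?normr_gt0// (le_trans (H _))//.
  rewrite normrZ; rewrite ltr_pdivlMr// in hr'.
  by rewrite (le_lt_trans _ hr')// ler_wpM2l// lerDl.
rewrite normrZ mulrCA ler_wpM2l// mulrAC ler_pdivrMr// ler_wpM2l ?(ltW e0)//.
by rewrite lerDl.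
Qed.

Lemma rel_derivative_cvg (R : realType) (V W : normedModType R) (A : set V)
    (f : V -> W) (x : V) (L : {linear V -> W}) :
  continuous L -> rel_derivative A f x L ->
  f y @[y --> within A (nbhs x)] --> f x.
Proof.
move=> /linear_lipschitz[k k0 Lk] /rel_derivativeP fL.
have [r r0 Hr] := fL 1 ltr01.
have k1 : 0 < k + 1 by rewrite addr_gt0.
apply/cvgrPdist_le => e e0; rewrite near_withinE; apply/nbhs_normP.
exists (Num.min r (e / (k + 1))); first by rewrite /= lt_min r0 divr_gt0.
move=> y; rewrite /= distrC lt_min ltr_pdivlMr// => /andP[yr ye] Ay.
rewrite distrC -(subrK (L (y - x)) (f y - f x)) (le_trans (ler_normD _ _))//.
rewrite (le_trans (lerD (Hr y Ay yr) (Lk _)))//.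
by rewrite -mulrDl addrC mulrC ltW.
Qed.

(** [C1_on] provides bare linear maps; on this finite-dimensional domain they are continuous, being
    determined by finitely many values. *)
Lemma linear_pair_continuous (R : realType) n (W : normedModType R)
    (L : {linear ('rV[R]_n * R)%type -> W}) : continuous L.
Proof.
have LE q : L q = \sum_k q.1 0 k *: L (basis_vec k, 0) + q.2 *: L (0, 1).
  rewrite -linearZ_LR -(eq_bigr _ (fun k _ => linearZ_LR L _ _)) -linear_sum -linearD.
  congr (L _); rewrite [LHS]surjective_pairing; congr (_, _) => /=.
    by rewrite (raddf_sum fst)/= scaler0 addr0 -row_sum_basis.
  rewrite (raddf_sum snd)/= [_ *: 1]mulr1 big1 ?add0r// => k _.
  by rewrite scaler0.
pose g (q : 'rV[R]_n * R) := \sum_k q.1 0 k *: L (basis_vec k, 0) + q.2 *: L (0, 1).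
have gL : g = L by apply/funext => q; rewrite LE.
suff gc : continuous g by rewrite gL in gc; exact: gc.
move=> q; rewrite /g.
apply: cvgD; last by apply: cvgZr_tmp; exact: cvg_snd.
apply: cvg_big => [|k _]; first exact: add_continuous.
apply: cvgZr_tmp.
have q1 : p.1 @[p --> q] --> q.1 by exact: cvg_fst.
exact: (cvg_comp _ (fun v : 'rV[R]_n => v 0 k) q1 (@coord_continuous _ _ _ 0 k q.1)).
Qed.

Section Chi.
Context {R : realType} {n : nat}.
Variables (u : 'rV[R]_n.+1 -> R -> 'rV[R]_n.+1)
  (phi : R -> R -> 'rV[R]_n.+1 -> 'rV[R]_n.+1).
Hypotheses (hu : C1_velocity u) (hwp : well_posed u) (hphi : is_flow_map u phi).
Variables (t0 k : R) (hk : 0 < k) (S : 'rV[R]_n -> R -> 'rV[R]_n.+1).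
Local Notation K := (closure (cube n) `*` `[t0, t0 + k]).
Local Notation Sp := (fun q : 'rV[R]_n * R => S q.1 q.2).
Variable DS : 'rV[R]_n * R -> {linear ('rV[R]_n * R)%type -> 'rV[R]_n.+1}.
Hypothesis HDS : forall q, K q -> rel_derivative K Sp q (DS q).
Hypothesis DSc : forall v, {within K, continuous (fun q => DS q v)}.
Local Notation X := (position phi).
Local Notation J := (position_jac phi).
Local Notation chi := (chi phi S t0 k).
Local Notation V := 'rV[R]_n.+1.

(** The affine map that turns the cube parameter into space and time arguments of [S]; [chi_dir] is
    its linear part. *)
Definition chi_arg (y : V) : 'rV[R]_n * R := (col' ord_max y, t0 + y 0 ord_max * k).
Definition chi_dir (w : V) : 'rV[R]_n * R := (col' ord_max w, w 0 ord_max * k).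
Local Notation Q := chi_arg.

(** Candidate for [pderiv chi a y], given by the chain rule. It makes sense and is continuous
    relative to the whole closed cube, also where no two-sided derivative of [chi] is available. *)
Definition chi_partial (a : 'I_n.+1) (y : V) : V :=
  (DS (Q y) (chi_dir (basis_vec a)) -
     (chi_dir (basis_vec a)).2 *: u (Sp (Q y)) (Q y).2)
  *m J t0 (Q y).2 (Sp (Q y)).

Lemma chiE y : chi y = X (Q y).2 (Sp (Q y)) t0.
Proof. by rewrite /position /= opprD addrA subrr sub0r. Qed.

Lemma chi_arg_in y : closed_cube n.+1 y -> K (Q y).
Proof.
move=> yc; split=> /=; first by rewrite closure_cube => j; rewrite mxE.
rewrite in_itv/= lerDl lerD2l; have /andP[y0 y1] := yc ord_max.
by rewrite mulr_ge0 ?ler_piMl// ltW.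
Qed.

Lemma chi_arg_line y w (h : R) : Q (y + h *: w) = Q y + h *: chi_dir w.
Proof.
congr (_, _) => /=; first by apply/rowP => j; rewrite !mxE.
by rewrite !mxE mulrDl addrA -mulrA.
Qed.

Lemma chi_derive i s y a : face i s y -> a != i ->
  is_derive y (basis_vec a) chi (chi_partial a y).
Proof.
move=> yf ai; apply/is_derive_lineP.
have [r r0 Hr] := face_line yf ai.
pose w := chi_dir (basis_vec a).
have -> : (fun h : R => chi (y + h *: basis_vec a)) =
    (fun h => X ((Q y).2 + h *: w.2) (Sp (Q y + h *: w)) t0).
  by apply/funext => h; rewrite chiE chi_arg_line.
have Kl : exists2 r : R, 0 < r & forall h : R, `|h| < r -> K (Q y + h *: w).
  exists r => // h /Hr hf; rewrite -chi_arg_line.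
  exact: chi_arg_in (face_closed_cube hf).
have dS := rel_derivative_line (HDS (chi_arg_in (face_closed_cube yf))) Kl.
have := position_curve_derive hu hwp hphi t0 dS (is_derive_line (Q y).2 w.2 0).
by rewrite !scale0r !addr0.
Qed.

Lemma chi_arg_cvg y : closed_cube n.+1 y ->
  Q x @[x --> within (closed_cube n.+1) (nbhs y)] --> within K (nbhs (Q y)).
Proof.
move=> yc P KP.
have Zc : (col' ord_max x : 'rV[R]_n) @[x --> y] --> (col' ord_max y : 'rV[R]_n).
  apply: (@cvg_mxP R _ (nbhs y) _ 1 n (fun x => col' ord_max x) _).2 => i j.
  rewrite mxE; under eq_fun do rewrite mxE.
  exact: coord_continuous.
have Tc : t0 + (x : V) 0 ord_max * k @[x --> y] --> t0 + y 0 ord_max * k.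
  have yl : (x : V) 0 ord_max @[x --> y] --> y 0 ord_max by exact: coord_continuous.
  exact: (cvgD (cvg_cst _) (cvgM yl (cvg_cst _))).
have Qc : Q x @[x --> y] --> Q y by exact: (cvg_pair_norm Zc Tc).
apply: (@filterS _ (nbhs y) _ _ _ _ (Qc _ KP)) => x KPx xc; apply: KPx.
exact: chi_arg_in.
Qed.

Lemma S_cvg q : K q -> Sp x @[x --> within K (nbhs q)] --> Sp q.
Proof.
move=> Kq; exact: (rel_derivative_cvg (@linear_pair_continuous _ _ _ (DS q)) (HDS Kq)).
Qed.

Let SQ_cvg y : closed_cube n.+1 y ->
  (Sp (Q x), (Q x).2) @[x --> within (closed_cube n.+1) (nbhs y)] -->
  (Sp (Q y), (Q y).2).
Proof.
move=> yc; have Qy := chi_arg_cvg yc.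
apply: cvg_pair_norm => /=.
  exact: (cvg_comp _ Sp Qy (S_cvg (chi_arg_in yc))).
have Q2 : q.2 @[q --> within K (nbhs (Q y))] --> (Q y).2.
  by apply: cvg_within_filter; exact: cvg_snd.
exact: (cvg_comp _ _ Qy Q2).
Qed.

Lemma chi_cvg y : closed_cube n.+1 y ->
  chi x @[x --> within (closed_cube n.+1) (nbhs y)] --> chi y.
Proof.
move=> yc; rewrite chiE; under eq_fun do rewrite chiE.
have Xc : continuous (fun q : V * R => X q.2 q.1 t0).
  exact: position_continuous hu hwp hphi t0.
exact: (cvg_comp _ (fun q : V * R => X q.2 q.1 t0) (SQ_cvg yc) (Xc _)).
Qed.

Lemma chi_partial_cvg a y : closed_cube n.+1 y ->
  chi_partial a x @[x --> within (closed_cube n.+1) (nbhs y)] --> chi_partial a y.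
Proof.
move=> yc; apply: cvg_mulmx.
  apply: cvgB.
    have /subspace_continuousP/(_ _ (chi_arg_in yc)) := DSc (v := chi_dir (basis_vec a)).
    exact: (cvg_comp _ _ (chi_arg_cvg yc)).
  apply: cvgZl_tmp.
  have uc : u q.1 q.2 @[q --> (Sp (Q y), (Q y).2)] --> u (Sp (Q y)) (Q y).2.
    exact: (differentiable_continuous (hu.1 (Sp (Q y), (Q y).2))).
  exact: (cvg_comp _ (fun q : V * R => u q.1 q.2) (SQ_cvg yc) uc).
have Jc : continuous (fun q : V * R => J t0 q.2 q.1).
  exact: position_jac_continuous hu hwp hphi t0.
exact: (cvg_comp _ (fun q : V * R => J t0 q.2 q.1) (SQ_cvg yc) (Jc _)).
Qed.

Lemma chi_face_cvg i s y a : face i s y -> a != i ->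
  derivable chi y (basis_vec a) /\
  pderiv chi a x @[x --> within (face i s) (nbhs y)] --> pderiv chi a y.
Proof.
move=> yf ai; split; first by case: (chi_derive yf ai).
have yc := face_closed_cube yf.
have fE x : face i s x -> pderiv chi a x = chi_partial a x.
  by move=> xf; case: (chi_derive xf ai).
rewrite fE//.
have H : chi_partial a x @[x --> within (face i s) (nbhs y)] --> chi_partial a y.
  move=> P /(chi_partial_cvg (a := a) yc).
  by apply: within_subset => x; exact: face_closed_cube.
apply: cvg_trans H; apply: near_eq_cvg; rewrite near_withinE; near=> x.
by move=> /fE.
Unshelve. all: by end_near. Qed.

End Chi.

(** * The faces of the cube and the pieces of the generating cycle *)

Section Faces.
Context {R : realType} {n : nat}.
Variables (u : 'rV[R]_n.+1 -> R -> 'rV[R]_n.+1)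
  (phi : R -> R -> 'rV[R]_n.+1 -> 'rV[R]_n.+1).
Hypotheses (hu : C1_velocity u) (hwp : well_posed u) (hphi : is_flow_map u phi).
Variables (t0 k : R) (hk : 0 < k) (S : 'rV[R]_n -> R -> 'rV[R]_n.+1).
Hypothesis hS : moving_hypersurface S t0 k.
Local Notation K := (closure (cube n) `*` `[t0, t0 + k]).
Local Notation Sp := (fun q : 'rV[R]_n * R => S q.1 q.2).
Variable DS : 'rV[R]_n * R -> {linear ('rV[R]_n * R)%type -> 'rV[R]_n.+1}.
Hypothesis HDS : forall q, K q -> rel_derivative K Sp q (DS q).
Local Notation X := (position phi).
Local Notation J := (position_jac phi).
Local Notation chi := (chi phi S t0 k).
Local Notation Q := (chi_arg t0 k).
Local Notation V := 'rV[R]_n.+1.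
Local Notation top := (@ord_max n).

(** At a fixed time the box contains a full neighbourhood of [z] in space, so the relative
    derivative restricts to an ordinary one, even at the end times. *)
Lemma hsurf_diff z t : cube n z -> t0 <= t <= t0 + k ->
  differentiable (S^~ t) z /\ forall v, 'd (S^~ t) z v = DS (z, t) (v, 0).
Proof.
move=> zc tk; pose L0 (v : 'rV[R]_n) := DS (z, t) (v, 0).
have L0lin : linear L0.
  move=> c x y; rewrite /L0 -linearP; congr (DS _ _).
  by congr (_, _); rewrite /= scaler0 addr0.
pose L : {linear 'rV[R]_n -> 'rV[R]_n.+1} :=
  HB.pack L0 (GRing.isLinear.Build _ _ _ _ _ L0lin).
have Lc : continuous L.
  move=> v; have v0 : (x, 0 : R) @[x --> v] --> (v, 0 : R).
    exact: (cvg_pair_norm cvg_id (cvg_cst _)).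
  exact: (cvg_comp _ (DS (z, t)) v0 (@linear_pair_continuous _ _ _ (DS (z, t)) _)).
suff [? dE] : differentiable (S^~ t) z /\ 'd (S^~ t) z = L :> (_ -> _).
  by split=> // v; rewrite dE.
apply: differentiable_of_bound => // e e0.
have zt : K (z, t) by split => /=; [exact: subset_closure|rewrite in_itv].
have /rel_derivativeP/(_ _ e0)[r r0 Hr] := HDS zt.
have : \forall x \near z, (cube n)° x.
  by apply: open_nbhs_nbhs; split; [exact: open_interior|rewrite interior_cube].
rewrite interior_cube => /nbhs_normP[r' /= r'0 Hr'].
exists (Num.min r r'); first by rewrite lt_min r0.
move=> y; rewrite lt_min => /andP[yr yr'].
have yK : K (y, t).
  split => /=; last by rewrite in_itv.
  by apply: subset_closure; apply: Hr'; rewrite /= distrC.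
have E : (y, t) - (z, t) = (y - z, 0) :> 'rV[R]_n * R by congr (_, _); rewrite /= subrr.
have := Hr (y, t) yK; rewrite E prod_normE /= normr0 max_l//.
by move=> /(_ yr).
Qed.

Lemma face_top_cube s y : face top s y -> cube n (Q y).1.
Proof. by move=> [_ yj] j; rewrite mxE; apply: yj; rewrite eq_sym neq_lift. Qed.

Lemma face_top_time s y : face top s y -> (Q y).2 = t0 + s%:R * k.
Proof. by move=> [ys _]; rewrite /= ys. Qed.

Lemma face_top_time_in s y : face top s y -> t0 <= (Q y).2 <= t0 + k.
Proof.
move=> /face_top_time->; rewrite lerDl lerD2l.
by case: s; rewrite ?mul1r ?mul0r lexx ltW.
Qed.

(** Time is constant on these faces, so the [u] term of [chi_partial] drops out. *)
Lemma chi_pderiv_top s y j : face top s y ->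
  pderiv chi (lift top j) y =
    pderiv (S^~ (Q y).2) j (Q y).1 *m J t0 (Q y).2 (Sp (Q y)).
Proof.
move=> yf; have jt : lift top j != top by rewrite eq_sym neq_lift.
have [_ dE] := chi_derive hu hwp hphi hk HDS yf jt.
rewrite [LHS]dE.
have [dS dSE] := hsurf_diff (face_top_cube yf) (face_top_time_in yf).
rewrite /chi_partial /pderiv (deriveE _ dS) dSE.
have -> : chi_dir k (basis_vec (lift top j)) = (basis_vec j, 0).
  congr (_, _); last by rewrite mxE (negbTE (neq_lift _ _)) andbF mul0r.
  by apply/rowP => l; rewrite !mxE (inj_eq lift_inj).
by rewrite scale0r subr0.
Qed.

Lemma regular_top s y : face top s y -> regular_point chi top y.
Proof.
move=> yf; rewrite /regular_point.
have -> : row' top (\matrix_a pderiv chi a y) =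
    'J (S^~ (Q y).2) (Q y).1 *m J t0 (Q y).2 (Sp (Q y)).
  apply/row_matrixP => j; rewrite row_mul -[row j (row' _ _)]/(row j (rowsub _ _)).
  rewrite row_rowsub rowK (chi_pderiv_top _ yf); congr (_ *m _).
  have [dS _] := hsurf_diff (face_top_cube yf) (face_top_time_in yf).
  by rewrite /pderiv (deriveEjacobian _ dS) rowE.
have [_ _ rk _] := hS.
rewrite /row_free mxrankMfree; first exact/eqP/(rk _ (face_top_time_in yf) _ (face_top_cube yf)).
by rewrite row_free_unit; exact: position_jac_unit hu hwp hphi _ _ _.
Qed.

Lemma chi_bottom y : face top false y -> chi y = S (Q y).1 t0.
Proof.
move=> yf; rewrite chiE (face_top_time yf) mul0r addr0.
exact: position_id hwp hphi _ _.
Qed.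

Lemma pderiv_bottom y j : face top false y ->
  pderiv chi (lift top j) y = pderiv (S^~ t0) j (Q y).1.
Proof.
move=> yf; rewrite (chi_pderiv_top _ yf) (face_top_time yf) mul0r addr0.
suff -> p : J t0 t0 p = 1%:M by rewrite mulmx1.
apply/row_matrixP => a; rewrite rowK row1.
have -> : (fun p => X t0 p t0) = id by apply/funext => x; exact: position_id hwp hphi _ _.
exact: derive_id.
Qed.

(** The tangents coincide, and the weak sign of the cycle rule becomes strict because equality
    occurs only at singular points. *)
Lemma hsurf_normal_bottom y v : face top false y ->
  cycle_normal chi top false y v -> hsurf_normal S t0 (Q y).1 v.
Proof.
move=> yf [v1 vo vw v0]; split => //.
  by move=> j; rewrite -(pderiv_bottom _ yf) vo// eq_sym neq_lift.
have wE : (fun j => if unlift top j is Some i then pderiv (S^~ t0) i (Q y).1 else v) =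
    (fun j => if j == top then v else pderiv chi j y).
  apply/funext => j; case: unliftP => [i ->|->]; last by rewrite eqxx.
  by rewrite eq_sym (negbTE (neq_lift _ _)) pderiv_bottom.
rewrite wE lt_neqAle vw andbT; apply/eqP => /v0.
by rewrite (regular_top yf).
Qed.

(* The point (z, tau) of R^m, with tau as its last coordinate. *)
Definition cyl (z : 'rV[R]_n) (tau : R) : V :=
  \row_a (if unlift top a is Some j then z 0 j else tau).

Lemma cyl_arg z tau : Q (cyl z tau) = (z, t0 + tau * k).
Proof.
congr (_, _); last by rewrite mxE unlift_none.
by apply/rowP => j; rewrite !mxE liftK.
Qed.

Lemma cyl_lift z tau j : cyl z tau 0 (lift top j) = z 0 j.
Proof. by rewrite mxE liftK. Qed.

Lemma cyl_top z tau : cyl z tau 0 top = tau.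
Proof. by rewrite mxE unlift_none. Qed.

Lemma cyl_eta y : y = cyl (Q y).1 (y 0 top).
Proof. by apply/rowP => a; rewrite mxE; case: unliftP => [j ->|->]; rewrite ?mxE. Qed.

Lemma closed_cube_cyl z tau :
  closed_cube n.+1 (cyl z tau) <-> closed_cube n z /\ 0 <= tau <= 1.
Proof.
split=> [yc|[zc tauc] a].
  by split=> [j|]; [have := yc (lift top j); rewrite cyl_lift|have := yc top; rewrite cyl_top].
by case: (unliftP top a) => [j ->|->]; rewrite ?cyl_lift ?cyl_top.
Qed.

Lemma face_top_cyl s z tau : face top s (cyl z tau) <-> cube n z /\ tau = s%:R.
Proof.
rewrite /face /=; split=> [[]|[zc ->]].
  rewrite cyl_top => -> yc; split=> // j.
  by have := yc (lift top j); rewrite cyl_lift; apply; rewrite eq_sym neq_lift.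
split; first by rewrite cyl_top.
by move=> a; case: (unliftP top a) => [j ->|->]; rewrite ?cyl_lift ?eqxx.
Qed.

Lemma lateral_cyl z tau :
  lateral_faces (cyl z tau) <-> frontier (cube n) z /\ 0 <= tau <= 1.
Proof.
rewrite frontier_cubeP; split.
  move=> [a [s [at_]]]; rewrite closure_face => -[ya /closed_cube_cyl[zc tauc]].
  split=> //; split=> //; case: (unliftP top a) at_ ya => [j ->|->]; last by rewrite eqxx.
  by rewrite cyl_lift => _ zj; exists j, s.
move=> [[zc [j [s zj]]] tauc]; exists (lift top j), s.
split; first by rewrite eq_sym neq_lift.
by rewrite closure_face; split; [rewrite cyl_lift|exact/closed_cube_cyl].
Qed.

Lemma chi_cyl z tau :
  chi (cyl z tau) = phi (t0 + tau * k) (- (tau * k)) (S z (t0 + tau * k)).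
Proof.
have [zE tE] : (Q (cyl z tau)).1 = z /\ (Q (cyl z tau)).2 = t0 + tau * k.
  by rewrite cyl_arg.
by rewrite -[in RHS]zE -[X in - (X * k)](cyl_top z) -tE.
Qed.

Lemma chi_lateral : chi @` lateral_faces = streak_hsurf phi S t0 k.
Proof.
apply/seteqP; split.
  move=> _ [y + <-]; rewrite [y]cyl_eta => /lateral_cyl[zf tauc].
  by rewrite chi_cyl; exists (Q y).1, (y 0 top).
move=> _ [z [tau [zf tauc ->]]]; exists (cyl z tau); first exact/lateral_cyl.
exact: chi_cyl.
Qed.

(** The edges of the faces [z_m = 0, 1] go to the closed lateral faces, just as the streak
    hypersurface, and not [hsurf], takes the boundary of the parameter cube. *)
Lemma frontier_cylP z tau : frontier (cube n.+1) (cyl z tau) <->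
  [\/ lateral_faces (cyl z tau), face top false (cyl z tau)
    | face top true (cyl z tau)].
Proof.
rewrite frontier_cubeP; split; last first.
  case=> [[a [s [_]]]|yf|yf].
  - by rewrite closure_face => -[ya yc]; split => //; exists a, s.
  - by split; [exact: face_closed_cube yf|exists top, false; case: yf].
  - by split; [exact: face_closed_cube yf|exists top, true; case: yf].
move=> [yc [a [s ya]]]; have [zc tauc] := (closed_cube_cyl _ _).1 yc.
have [zi|zni] := pselect (cube n z); last first.
  apply: Or31; apply/lateral_cyl; split => //; split; first by rewrite closure_cube.
  by rewrite interior_cube.
case: (unliftP top a) ya => [j ->|->].
  rewrite cyl_lift => zj; have := zi j; rewrite zj.
  by case: (s); rewrite ltxx ?andbF.
rewrite cyl_top => taus.
by case: s taus => taus; [apply: Or33|apply: Or32]; apply/face_top_cyl.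
Qed.

Lemma chi_bottom_bij : set_bij (face top false) (hsurf S t0) chi.
Proof.
split.
- by move=> y yf; rewrite /= chi_bottom//; exists (Q y).1 => //; exact: face_top_cube yf.
- move=> y y' /set_mem yf /set_mem y'f; rewrite !chi_bottom// => SE.
  have [_ Sinj _ _] := hS.
  have t0k : t0 <= t0 <= t0 + k by rewrite lexx lerDl ltW.
  rewrite [y]cyl_eta [y']cyl_eta yf.1 y'f.1; congr cyl.
  by apply: (Sinj _ t0k) SE; apply/mem_set;
    [exact: face_top_cube yf|exact: face_top_cube y'f].
- move=> _ [z zc <-]; have yf : face top false (cyl z 0) by apply/face_top_cyl.
  by exists (cyl z 0) => //; rewrite chi_bottom// cyl_arg.
Qed.

Lemma chi_top_bij : set_bij (face top true) (pulled_back_hsurf phi S t0 k) chi.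
Proof.
have chiT y : face top true y -> chi y = phi (t0 + k) (- k) (S (Q y).1 (t0 + k)).
  by move=> [yt _]; rewrite [in LHS](cyl_eta y) chi_cyl yt !mul1r.
split.
- move=> y yf; rewrite /= chiT//; exists (S (Q y).1 (t0 + k)) => //.
  by exists (Q y).1 => //; exact: face_top_cube yf.
- move=> y y' /set_mem yf /set_mem y'f; rewrite !chiE.
  have [_ Sinj _ _] := hS.
  have tk : t0 <= t0 + k <= t0 + k by rewrite lexx lerDl ltW.
  rewrite (face_top_time yf) (face_top_time y'f) mul1r.
  (* Flowing from [t0] to [t0 + k] undoes the pullback. *)
  move=> /(congr1 (fun p => X t0 p (t0 + k))).
  rewrite !(position_trans hwp hphi) !(position_id hwp hphi) => SE.
  rewrite [y]cyl_eta [y']cyl_eta yf.1 y'f.1; congr cyl.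
  by apply: (Sinj _ tk) SE; apply/mem_set;
    [exact: face_top_cube yf|exact: face_top_cube y'f].
- move=> _ [_ [z zc <-] <-]; exists (cyl z 1); first exact/face_top_cyl.
  by rewrite chi_cyl !mul1r.
Qed.

Lemma chi_image : generating_cycle phi S t0 k = chi @` frontier (cube n.+1).
Proof.
apply/seteqP; split.
  move=> x [[]|].
  - have [_ _ /[apply]] := chi_bottom_bij.
    move=> [y yf <-]; exists y => //; rewrite [y]cyl_eta in yf *.
    by apply/frontier_cylP; apply: Or32.
  - have [_ _ /[apply]] := chi_top_bij.
    move=> [y yf <-]; exists y => //; rewrite [y]cyl_eta in yf *.
    by apply/frontier_cylP; apply: Or33.
  - rewrite -chi_lateral => -[y yf <-]; exists y => //; rewrite [y]cyl_eta in yf *.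
    by apply/frontier_cylP; apply: Or31.
move=> _ [y + <-]; rewrite [y]cyl_eta => /frontier_cylP[yf|yf|yf].
- by right; rewrite -chi_lateral; exists (cyl (Q y).1 (y 0 top)).
- by left; left; have [+ _ _] := chi_bottom_bij; apply.
- by left; right; have [+ _ _] := chi_top_bij; apply.
Qed.

Lemma chi_continuous : {within frontier (cube n.+1), continuous chi}.
Proof.
apply/subspace_continuousP => y /frontier_cubeP[yc _] P.
move=> /(chi_cvg hu hwp hphi hk HDS yc).
by apply: within_subset => x /frontier_cubeP[].
Qed.

End Faces.

Theorem lemma3p13 (R : realType) (n : nat) (hm : (2 <= n.+1)%N)
    (u : 'rV[R]_n.+1 -> R -> 'rV[R]_n.+1)
    (phi : R -> R -> 'rV[R]_n.+1 -> 'rV[R]_n.+1)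
    (hu : C1_velocity u) (hwp : well_posed u) (hphi : is_flow_map u phi)
    (t0 k : R) (hk : 0 < k)
    (S : 'rV[R]_n -> R -> 'rV[R]_n.+1) (hS : moving_hypersurface S t0 k) :
  let G := generating_cycle phi S t0 k in
  [/\ orientable_cycle G,
      G = chi phi S t0 k @` frontier (cube n.+1)
    & exists psi N : 'rV[R]_n.+1 -> 'rV[R]_n.+1,
      [/\ cycle_param psi G,
          cycle_orientation psi N,
          (* the face z_m = 0 *)
          set_bij (face ord_max false) (hsurf S t0) psi /\
          (forall z, face ord_max false z ->
             (forall v, cycle_normal psi ord_max false z v <-> v = N z) /\
             (forall z', cube n z' -> S z' t0 = psi z ->
                hsurf_normal S t0 z' (N z))),
          (* the face z_m = 1 *)
          set_bij (face ord_max true) (pulled_back_hsurf phi S t0 k) psi /\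
          (forall z, face ord_max true z ->
             forall v, cycle_normal psi ord_max true z v <-> v = N z)
        & (* the faces z_i = 0, 1 with i < m *)
          psi @` lateral_faces = streak_hsurf phi S t0 k /\
          (forall i s z, i != ord_max -> face i s z ->
             cycle_normal psi i s z (N z))]].
Proof.
move=> G; have [[DS [HDS DSc]] Sinj _ _] := hS.
have GE : G = chi phi S t0 k @` frontier (cube n.+1).
  exact: (chi_image hwp hphi hk hS).
have par : cycle_param (chi phi S t0 k) G.
  by split; [exact: (chi_continuous hu hwp hphi hk HDS)|rewrite GE].
have [N NP] := cycle_orientation_exists (fun i s z zf a ai =>
  chi_face_cvg hu hwp hphi hk HDS DSc zf ai).
(* All points of these two faces are regular, so the rule leaves [N z] as the only choice. *)
have normalP s z : face ord_max s z ->
    forall v, cycle_normal (chi phi S t0 k) ord_max s z v <-> v = N z.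
  move=> zf v; have [_ nN _] := NP _ _ _ zf; split=> [nv|->//].
  exact: (face_normal_unique (regular_top hu hwp hphi hk hS HDS zf) nN nv).
split=> //; first by exists (chi phi S t0 k), N.
exists (chi phi S t0 k), N; split => //.
- split; first exact: (chi_bottom_bij hwp hphi hk hS).
  move=> z zf; split; first exact: normalP.
  move=> z' z'c; rewrite (chi_bottom hwp hphi t0 k S zf) => SE.
  have t0k : t0 <= t0 <= t0 + k by rewrite lexx lerDl ltW.
  (* Injectivity of [S] at time [t0] identifies any parameter of the point [psi z] with the one
     given by [z]. *)
  have -> : z' = (chi_arg t0 k z).1.
    by apply: (Sinj _ t0k) SE; apply/mem_set => //; exact: (face_top_cube t0 k zf).
  apply: (hsurf_normal_bottom hu hwp hphi hk hS HDS zf).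
  exact/normalP.
- by split; [exact: (chi_top_bij hwp hphi hk hS)|exact: normalP].
- split; first exact: chi_lateral.
  by move=> i s z _ zf; have [_ + _] := NP _ _ _ zf.
Qed.
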